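(* Let $(Y,\mathbf{X})\sim N(\boldsymbol{\mu},\Sigma)$ and $(Y',\mathbf{X}')\sim N(\boldsymbol{\mu}',\Sigma')$ be multivariate normal random vectors (of dimensions $1+p$ and $1+p'$, with $Y,Y'$ real-valued and possibly singular covariance matrices) such that the components $Y$ and $Y'$ are non-degenerate. Decompose $$\Sigma=\begin{pmatrix}\sigma_Y^2&\Sigma_{Y,\mathbf{X}}\\ \Sigma_{\mathbf{X},Y}&\Sigma_{\mathbf{X}}\end{pmatrix},\qquad \Sigma'=\begin{pmatrix}\sigma_{Y'}^2&\Sigma_{Y',\mathbf{X}'}\\ \Sigma_{\mathbf{X}',Y'}&\Sigma_{\mathbf{X}'}\end{pmatrix}.$$ Then $$(Y,\mathbf{X})\preccurlyeq_{ccx}(Y',\mathbf{X}')\quad\Longleftrightarrow\quad \Sigma_{Y,\mathbf{X}}\Sigma_{\mathbf{X}}^-\Sigma_{\mathbf{X},Y}/\sigma_Y^2\;\le\;\Sigma_{Y',\mathbf{X}'}\Sigma_{\mathbf{X}'}^-\Sigma_{\mathbf{X}',Y'}/\sigma_{Y'}^2 .$$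
   Context: $\Sigma_{Y,\mathbf{X}}$ is the row vector of covariances of $Y$ with the components of $\mathbf{X}$, $\Sigma_{\mathbf{X},Y}$ its transpose, $\Sigma_{\mathbf{X}}$ the covariance matrix of $\mathbf{X}$, $\sigma_Y^2=\mathrm{Var}(Y)$, and $\Sigma_{\mathbf{X}}^-$ a generalized inverse of $\Sigma_{\mathbf{X}}$ such as the Moore-Penrose inverse. $q_Y(v)=\inf\{y\mid F_Y(y)\ge v\}$, $v\in(0,1)$, with $F_Y$ the distribution function of $Y$. For bounded random variables, $S\le_{cx}T$ means $\mathbb{E}\varphi(S)\le\mathbb{E}\varphi(T)$ for all convex $\varphi\colon\mathbb{R}\to\mathbb{R}$. Conditional convex order: $(Y,\mathbf{X})\preccurlyeq_{ccx}(Y',\mathbf{X}')$ means $P(Y\ge q_Y(v)\mid\mathbf{X})\le_{cx}P(Y'\ge q_{Y'}(v)\mid\mathbf{X}')$ for all $v\in(0,1)$. *)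

(* Defs.v *)
From HB Require Import structures.
From mathcomp Require Export all_boot all_order all_algebra.
From mathcomp Require Export all_classical all_reals all_analysis.
Set Implicit Arguments.
Unset Strict Implicit.
Unset Printing Implicit Defensive.
Import Order.TTheory GRing.Theory Num.Theory.
Import numFieldNormedType.Exports.
Local Open Scope classical_set_scope.
Local Open Scope ring_scope.

(* The normal law with mean m and variance v >= 0.  [normal_prob] takes the
   standard deviation, and is not the Dirac mass when that is 0. *)
Definition normal_law (R : realType) (m v : R) (A : set R) : \bar R :=
  if v == 0 then \d_m A else normal_prob m (Num.sqrt v) A.

(* Z ~ N(mu, Sigma), Sigma possibly singular: every linear combination t Z of
   the components is normal with mean t mu and variance t Sigma t^T. *)
Definition mvnormal d (T : measurableType d) (R : realType)
    (P : probability T R) (n : nat) (Z : T -> 'cV[R]_n)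
    (mu : 'cV[R]_n) (Sigma : 'M[R]_n) : Prop :=
  [/\ Sigma^T = Sigma,
      forall t : 'rV[R]_n, 0 <= (t *m Sigma *m t^T) 0 0
    & forall (t : 'rV[R]_n) (A : set R), measurable A ->
        P [set w | A ((t *m Z w) 0 0)] =
        normal_law ((t *m mu) 0 0) ((t *m Sigma *m t^T) 0 0) A].

Definition joint_vector d (T : measurableType d) (R : realType)
    (P : probability T R) (p : nat) (Y : {RV P >-> R})
    (X : {RV P >-> p.-tuple R}) (w : T) : 'cV[R]_(1 + p) :=
  col_mx (Y w)%:M (\col_(i < p) tnth (X w) i).

Definition nondegenerate d (T : measurableType d) (R : realType)
    (P : probability T R) (Y : {RV P >-> R}) : Prop :=
  ~ exists c : R, {ae P, forall w, Y w = c}.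

Definition quantile d (T : measurableType d) (R : realType)
    (P : probability T R) (Y : {RV P >-> R}) (v : R) : R :=
  inf [set y | (v%:E <= cdf Y y)%E].

(* f is a version of the conditional probability P(A | X), that is, of the
   conditional expectation of the indicator of A given sigma(X). *)
Definition cond_prob_version d d' (T : measurableType d)
    (E : measurableType d') (R : realType) (P : probability T R)
    (X : {RV P >-> E}) (A : set T) (f : T -> R) : Prop :=
  [/\ measurable_fun [set: g_sigma_algebra_preimageType X] f,
      P.-integrable setT (EFin \o f)
    & forall B : set T, g_sigma_algebra_preimage X B ->
        (\int[P]_(w in B) (f w)%:E = P (A `&` B))%E].

(* Only used for almost surely bounded S and S', for which both expectations
   are finite. *)
Definition convex_le d d' (T : measurableType d) (T' : measurableType d')
    (R : realType) (P : probability T R) (P' : probability T' R)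
    (S : T -> R) (S' : T' -> R) : Prop :=
  forall phi : R -> R, convex_function [set: R^o] phi ->
    ('E_P[phi \o S] <= 'E_P'[phi \o S'])%E.

(* Conditional probabilities are defined almost surely only; quantifying over
   all versions is harmless, as the expectations do not depend on the choice. *)
Definition ccx_le d d' (T : measurableType d) (T' : measurableType d')
    (R : realType) (P : probability T R) (P' : probability T' R) (p p' : nat)
    (Y : {RV P >-> R}) (X : {RV P >-> p.-tuple R})
    (Y' : {RV P' >-> R}) (X' : {RV P' >-> p'.-tuple R}) : Prop :=
  forall v : R, 0 < v < 1 ->
  forall (f : T -> R) (f' : T' -> R),
    cond_prob_version X [set w | quantile Y v <= Y w] f ->
    cond_prob_version X' [set w | quantile Y' v <= Y' w] f' ->
    convex_le P P' f f'.

Definition ginverse (R : realType) (m n : nat) (A : 'M[R]_(m, n))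
    (G : 'M[R]_(n, m)) : Prop := A *m G *m A = A.

Lemma ginverse_pinvmx (R : realType) (m n : nat) (A : 'M[R]_(m, n)) :
  ginverse A (pinvmx A).
Proof. exact: mulmxKpV. Qed.

(* Sigma_{Y,X} G Sigma_{X,Y} / sigma_Y^2 in terms of the blocks of Sigma. *)
Definition explained_ratio (R : realType) (p : nat) (Sigma : 'M[R]_(1 + p))
    (G : 'M[R]_p) : R :=
  (ursubmx Sigma *m G *m dlsubmx Sigma) 0 0 / ulsubmx Sigma 0 0.

(* Main.v *)
(* The law of Y given X is normal with mean affine in X and constant variance,
   so P(Y >= q_Y(v) | X) is, up to a null set, a function of one standard normal
   variable that depends only on v and on the explained ratio r.  The joint law
   of (Y, X) is identified with that of (regression on X + independent noise, X)
   by the Cramer-Wold theorem, both sides having normal projections.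
   Increasing r amounts to conditioning on an additional independent normal
   variable, so Jensen's inequality gives the convex order; for the square the
   inequality is strict, which makes the order determine r. *)

Require Import Defs.
From mathcomp Require Import measurable_realfun ring lra.
Set Implicit Arguments.
Unset Strict Implicit.
Unset Printing Implicit Defensive.
Import Order.TTheory GRing.Theory Num.Theory.
Import numFieldNormedType.Exports.
Local Open Scope classical_set_scope.
Local Open Scope ring_scope.

(** * The Cramer-Wold theorem *)

(** Singularity is the obstacle, and it appears in three places. If $\Sigma_X$ is not invertible,
    positive semidefiniteness makes the covariance vector of $Y$ and $X$ vanish on its kernel, so
    the normal equations $b\Sigma_X=\Sigma_{Y,X}$ hold for every generalized inverse. If a linear
    combination has variance 0, or if the residual vanishes (ratio 1), a Dirac mass occurs. Both
    cases are absorbed by writing normal laws as images of the standard one under $x\mapsto m+sx$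
    with $s$ possibly zero. A joint density of $(Y,X)$ may then fail to exist, and the conditional
    law has to be recovered from one-dimensional projections; this is why the Cramer-Wold theorem is
    the central tool.

    For that theorem, real sines $\sin(tV+c)$ take the role of characters: their integrals are
    determined by the projections, the shift $c$ makes their span an algebra, and bounded pointwise
    limits lead from this algebra to indicators. *)

Lemma bernoulli_ineq (R : realDomainType) (x : R) (n : nat) :
  -1 <= x -> 1 + x *+ n <= (1 + x) ^+ n.
Proof.
move=> x1; elim: n => [|n IH]; first by rewrite mulr0n addr0 expr0.
rewrite exprS; apply: (@le_trans _ _ ((1 + x) * (1 + x *+ n))).
  rewrite -subr_ge0 (_ : _ - _ = x ^+ 2 *+ n) ?mulrn_wge0 ?sqr_ge0//.
  by rewrite mulrSr -[x *+ n]mulr_natr -[_ ^+ 2 *+ n]mulr_natr; ring.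
by rewrite ler_wpM2l// -lerBlDl sub0r.
Qed.

Section bounded_integrals.
Context d (T : measurableType d) (R : realType) (P : probability T R).

Lemma bounded_integrable (f : T -> R) (M : R) :
  measurable_fun setT f -> (forall w, `|f w| <= M) ->
  P.-integrable setT (EFin \o f).
Proof.
move=> mf fM; apply: measurable_bounded_integrable => //.
  by rewrite (le_lt_trans (probability_le1 P _))// ltry.
exists M; split; first exact: num_real.
by move=> N MN w _; exact: le_trans (fM w) (ltW MN).
Qed.

Lemma bounded_integral_lin (f g : T -> R) (M N a b : R) :
  measurable_fun setT f -> measurable_fun setT g ->
  (forall w, `|f w| <= M) -> (forall w, `|g w| <= N) ->
  (\int[P]_w (a * f w + b * g w)%:E =
   a%:E * \int[P]_w (f w)%:E + b%:E * \int[P]_w (g w)%:E)%E.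
Proof.
move=> mf mg fM gN.
have fi := bounded_integrable mf fM; have gi := bounded_integrable mg gN.
under eq_integral do rewrite EFinD !EFinM.
by rewrite integralD//= ?integralZl//; exact: integrableZl.
Qed.

Lemma integrable_le1 (f : T -> \bar R) : measurable_fun setT f ->
  (forall w, 0 <= f w <= 1)%E -> P.-integrable setT f.
Proof.
move=> mf f01; apply/integrableP; split => //.
apply: (@le_lt_trans _ _ (\int[P]_w cst 1 w)%E).
  apply: ge0_le_integral => //; first exact: measurableT_comp.
  by move=> w _; have /andP[f0 f1] := f01 w; rewrite gee0_abs.
rewrite integral_cst// mul1e.
by rewrite (le_lt_trans (probability_le1 P _))// ltry.
Qed.

End bounded_integrals.
Arguments bounded_integrable {d T R} P {f M}.

Lemma eq_law_integral d d' e (T : measurableType d) (T' : measurableType d')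
    (S : measurableType e) (R : realType) (P : probability T R)
    (P' : probability T' R) (X : T -> S) (X' : T' -> S) (f : S -> \bar R) :
  measurable_fun setT X -> measurable_fun setT X' -> measurable_fun setT f ->
  P.-integrable setT (f \o X) -> P'.-integrable setT (f \o X') ->
  (forall A, measurable A -> P (X @^-1` A) = P' (X' @^-1` A)) ->
  (\int[P]_w f (X w) = \int[P']_w f (X' w))%E.
Proof.
move=> mX mX' mf fX fX' PP'.
have /= := integral_pushforward mX mf fX measurableT.
have /= := integral_pushforward mX' mf fX' measurableT.
rewrite !preimage_setT => <- <-.
by apply: eq_measure_integral => A mA _; exact: PP'.
Qed.

(** * Indicators as limits of polynomials in a sine *)

Section step_functions.
Variable R : realType.
Implicit Type s : R.

Lemma cvg_indic_neq0 s : `|s| <= 1 ->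
  1 - (1 - s ^+ 2) ^+ k @[k --> \oo] --> ((s != 0)%R%:R : R).
Proof.
move=> s1; have [->|s0] := eqVneq s 0.
  apply: cvg_near_cst; near=> k.
  by rewrite expr0n/= subr0 expr1n subrr.
rewrite -[X in _ --> X]subr0; apply: cvgB; first exact: cvg_cst.
apply: cvg_expr; rewrite ger0_norm ?subr_ge0.
  by rewrite ltrBlDr ltrDl exprn_even_gt0.
by rewrite -real_normK ?num_real// expr_le1.
Unshelve. all: by end_near. Qed.

(* For [y = (1 + s) / 2], Bernoulli's inequality gives
   [1 - (2 y) ^ k <= (1 - y ^ k) ^ (2 ^ k) <= (2 y) ^ - k].  The factor
   [s != 0] removes the case [y = 1 / 2], where the power tends to [1 / e]. *)
Lemma cvg_indic_lt0 s : `|s| <= 1 ->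
  (s != 0)%R%:R * (1 - ((1 + s) / 2) ^+ k) ^+ (2 ^ k) @[k --> \oo]
    --> ((s < 0)%R%:R : R).
Proof.
rewrite ler_norml => /andP[s1 s2]; set y := (1 + s) / 2.
have y0 : 0 <= y by rewrite /y; lra.
have y1 : y <= 1 by rewrite /y; lra.
have yk0 k : 0 <= y ^+ k by rewrite exprn_ge0.
have yk1 k : y ^+ k <= 1 by rewrite exprn_ile1.
have q0 k : 0 <= (1 - y ^+ k) ^+ (2 ^ k) by rewrite exprn_ge0// subr_ge0.
have q1 k : (1 - y ^+ k) ^+ (2 ^ k) <= 1.
  by rewrite exprn_ile1 ?subr_ge0// gerBl.
case: (ltgtP s 0) => [sneg|spos|_] /=; rewrite ?mulr0n ?mulr1n; last first.
- by under eq_fun do rewrite mul0r; exact: cvg_cst.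
- under eq_fun do rewrite mul1r.
  have y2 : 1 < 2 * y by rewrite /y; lra.
  apply: (@squeeze_cvgr _ _ _ _ (cst 0) (fun k => (2 * y)^-1 ^+ k)).
  + near=> k; rewrite q0/= exprVn -[leRHS]mul1r.
    rewrite ler_pdivlMr ?exprn_gt0//; last lra.
    (* The product of [(1 - y ^ k) ^ (2 ^ k)] with the right-hand side of [B] is
       [(1 - y ^ (2 k)) ^ (2 ^ k) <= 1]; this yields the upper bound [(2 y) ^ - k]. *)
    have B : 1 + y ^+ k *+ 2 ^ k <= (1 + y ^+ k) ^+ (2 ^ k).
      by rewrite bernoulli_ineq// (le_trans _ (yk0 k))// oppr_le0.
    apply: (@le_trans _ _
      ((1 - y ^+ k) ^+ (2 ^ k) * (1 + y ^+ k) ^+ (2 ^ k))).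
      rewrite ler_wpM2l// (le_trans _ B)// exprMn -natrX mulr_natl.
      by rewrite lerDr.
    rewrite -exprMn -subr_sqr expr1n exprn_ile1 ?subr_ge0 ?gerBl ?sqr_ge0//.
    by rewrite expr_le1 ?yk0 ?yk1.
  + exact: cvg_cst.
  + apply: cvg_expr; rewrite gtr0_norm ?invr_gt0 ?invf_lt1//; lra.
- under eq_fun do rewrite mul1r.
  have y2 : `|2 * y| < 1 by rewrite ger0_norm /y; lra.
  apply: (@squeeze_cvgr _ _ _ _ (fun k => 1 - (2 * y) ^+ k) (cst 1)).
  + near=> k; rewrite q1 andbT exprMn -natrX mulr_natl -mulNrn.
    by apply: bernoulli_ineq; rewrite lerN2.
  + rewrite -[X in _ --> X]subr0; apply: cvgB; first exact: cvg_cst.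
    exact: cvg_expr.
  + exact: cvg_cst.
Unshelve. all: by end_near. Qed.

(** For large [k] the argument lies between [- pi] and [pi], where the sine has the sign of its
    argument. Shrinking the phase thus undoes the periodicity: half-spaces are obtained instead of
    unions of strips. *)
Lemma cvg_indic_sin_lt0 (x : R) :
  ((sin (k.+1%:R^-1 * x) < 0)%R%:R : R) @[k --> \oo] --> ((x < 0)%R%:R : R).
Proof.
have small (u : R) : 0 < u -> \forall k \near \oo, 0 < sin (k.+1%:R^-1 * u).
  move=> u0; near=> k; rewrite sin_gt0_pi// mulr_gt0//=.
  rewrite ltr_pdivrMl// -ltr_pdivrMr ?pi_gt0//.
  apply: (@lt_trans _ _ k%:R); last by rewrite ltr_nat.
  by near: k; exact: nbhs_infty_gtr.
apply: cvg_near_cst; case: (ltgtP x 0) => [x0|x0|->] /=.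
- have := small (- x); rewrite oppr_gt0 => /(_ x0); apply: filterS => k.
  by rewrite mulrN sinN oppr_gt0 => ->.
- have := small _ x0; apply: filterS => k /ltW; rewrite leNgt.
  by move=> /negbTE ->.
- by near=> k; rewrite mulr0 sin0 ltxx.
Unshelve. all: by end_near. Qed.

End step_functions.

Section cramer_wold_theorem.
Context d d' (T : measurableType d) (T' : measurableType d') (R : realType).
Variables (P : probability T R) (P' : probability T' R) (n : nat).
Variables (V : T -> 'cV[R]_n) (V' : T' -> 'cV[R]_n).
Hypothesis mV : forall i, measurable_fun setT (fun w => V w i 0).
Hypothesis mV' : forall i, measurable_fun setT (fun w => V' w i 0).
Hypothesis eq_proj : forall (t : 'rV[R]_n) (A : set R), measurable A ->
  P [set w | A ((t *m V w) 0 0)] = P' [set w | A ((t *m V' w) 0 0)].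

(** A shift [c] by [pi / 2] turns sines into cosines, so that sines of phases alone are closed under
    the product-to-sum formulas. Other shifts supply the thresholds of half-spaces. *)
Let phase S (U : S -> 'cV[R]_n) (t : 'rV[R]_n) (c : R) (w : S) : R :=
  (t *m U w) 0 0 + c.

Let measurable_phase e (S : measurableType e) (U : S -> 'cV[R]_n) t c :
  (forall i, measurable_fun setT (fun w => U w i 0)) ->
  measurable_fun setT (phase U t c).
Proof.
move=> mU; apply: measurable_funD => //.
rewrite (_ : (fun w => _) = fun w => \sum_i t 0 i * U w i 0).
  by apply: measurable_sum => i; apply: measurable_funM.
by apply/funext => w; rewrite mxE.
Qed.

Let measurable_sin_phase e (S : measurableType e) (U : S -> 'cV[R]_n) t c :
  (forall i, measurable_fun setT (fun w => U w i 0)) ->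
  measurable_fun setT (fun w => sin (phase U t c w)).
Proof.
move=> mU; apply: measurableT_comp (measurable_phase t c mU).
by apply: continuous_measurable_fun; exact: continuous_sin.
Qed.

Let sin_le1 (x : R) : `|sin x| <= 1.
Proof. by rewrite ler_norml sin_geN1 sin_le1. Qed.

(* Matching pairs of test functions: the relation is stable under
   multiplication by sin (t V + c), hence by polynomials in these, hence by
   their bounded pointwise limits, among which are indicators of half-spaces. *)
Let agree (h : T -> R) (h' : T' -> R) := [/\ measurable_fun setT h,
  measurable_fun setT h',
  exists M, (forall w, `|h w| <= M) /\ (forall w, `|h' w| <= M) &
  forall t c, (\int[P]_w (h w * sin (phase V t c w))%:E =
               \int[P']_w (h' w * sin (phase V' t c w))%:E)%E].

Let bnd_mul S (h k : S -> R) M N : (forall w, `|h w| <= M) ->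
  (forall w, `|k w| <= N) -> forall w, `|h w * k w| <= M * N.
Proof. by move=> hM kN w; rewrite normrM ler_pM. Qed.

Let bnd_lin S (h k : S -> R) M N a b : (forall w, `|h w| <= M) ->
  (forall w, `|k w| <= N) ->
  forall w, `|a * h w + b * k w| <= `|a| * M + `|b| * N.
Proof.
move=> hM kN w; rewrite (le_trans (ler_normD _ _))// !normrM.
by rewrite lerD// ler_wpM2l.
Qed.

Let agree_lin a b h h' k k' : agree h h' -> agree k k' ->
  agree (fun w => a * h w + b * k w) (fun w => a * h' w + b * k' w).
Proof.
move=> [mh mh' [M [hM hM']] hh] [mk mk' [N [kN kN']] kk]; split.
- by apply: measurable_funD; apply: measurable_funM.
- by apply: measurable_funD; apply: measurable_funM.
- by exists (`|a| * M + `|b| * N); split; exact: bnd_lin.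
move=> t c.
under eq_integral do rewrite mulrDl -!mulrA.
under [RHS]eq_integral do rewrite mulrDl -!mulrA.
rewrite (@bounded_integral_lin _ _ _ _ (fun w => h w * sin (phase V t c w))
  (fun w => k w * sin (phase V t c w)) (M * 1) (N * 1)).
- rewrite (@bounded_integral_lin _ _ _ _ (fun w => h' w * sin (phase V' t c w))
    (fun w => k' w * sin (phase V' t c w)) (M * 1) (N * 1)).
  + by rewrite hh kk.
  + exact: measurable_funM (measurable_sin_phase _ _ _).
  + exact: measurable_funM (measurable_sin_phase _ _ _).
  + exact: bnd_mul.
  + exact: bnd_mul.
- exact: measurable_funM (measurable_sin_phase _ _ _).
- exact: measurable_funM (measurable_sin_phase _ _ _).
- exact: bnd_mul.
- exact: bnd_mul.
Qed.

Let sin_mul (x y : R) :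
  sin x * sin y = 2^-1 * sin (x - y + pi / 2) - 2^-1 * sin (x + y + pi / 2).
Proof. rewrite !sinDpihalf cosB cosD; lra. Qed.

(** By [sin_mul], two sine factors along [t] and [s] become a combination of single sines along
    [t - s] and [t + s]. Agreement of [h] and [h'] covers all directions, hence both terms. *)
Let agree_sin t c h h' : agree h h' ->
  agree (fun w => h w * sin (phase V t c w))
        (fun w => h' w * sin (phase V' t c w)).
Proof.
move=> [mh mh' [M [hM hM']] hh]; split.
- exact: measurable_funM (measurable_sin_phase _ _ _).
- exact: measurable_funM (measurable_sin_phase _ _ _).
- by exists (M * 1); split; exact: bnd_mul.
move=> s b.
have E S (U : S -> 'cV[R]_n) (g : S -> R) w :
    g w * sin (phase U t c w) * sin (phase U s b w) =
    2^-1 * (g w * sin (phase U (t - s) (c - b + pi / 2) w)) +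
    (- 2^-1) * (g w * sin (phase U (t + s) (c + b + pi / 2) w)).
  have -> : phase U (t - s) (c - b + pi / 2) w =
      phase U t c w - phase U s b w + pi / 2.
    by rewrite /phase mulmxBl [(t *m U w - s *m U w) 0 0]mxE
      [(- (s *m U w)) 0 0]mxE; ring.
  have -> : phase U (t + s) (c + b + pi / 2) w =
      phase U t c w + phase U s b w + pi / 2.
    by rewrite /phase mulmxDl [(t *m U w + s *m U w) 0 0]mxE; ring.
  by rewrite -mulrA sin_mul; ring.
under eq_integral do rewrite E.
under [RHS]eq_integral do rewrite E.
rewrite (@bounded_integral_lin _ _ _ _ _ _ (M * 1) (M * 1)).
- rewrite (@bounded_integral_lin _ _ _ _ _ _ (M * 1) (M * 1)).
  + by rewrite !hh.
  + exact: measurable_funM (measurable_sin_phase _ _ _).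
  + exact: measurable_funM (measurable_sin_phase _ _ _).
  + exact: bnd_mul.
  + exact: bnd_mul.
- exact: measurable_funM (measurable_sin_phase _ _ _).
- exact: measurable_funM (measurable_sin_phase _ _ _).
- exact: bnd_mul.
- exact: bnd_mul.
Qed.

Let agree_lim (h_ : nat -> T -> R) (h'_ : nat -> T' -> R) h h' M :
  (forall k, agree (h_ k) (h'_ k)) ->
  (forall k w, `|h_ k w| <= M) -> (forall k w, `|h'_ k w| <= M) ->
  (forall w, h_ k w @[k --> \oo] --> h w) ->
  (forall w, h'_ k w @[k --> \oo] --> h' w) -> agree h h'.
Proof.
move=> ag hM hM' cvh cvh'.
have lim_bnd S (g : S -> R) (g_ : nat -> S -> R) :
    (forall k w, `|g_ k w| <= M) ->
    (forall w, g_ k w @[k --> \oo] --> g w) -> forall w, `|g w| <= M.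
  move=> gM cg w; have cn : `|g_ k w| @[k --> \oo] --> `|g w|.
    exact: cvg_norm (cg w).
  by apply: (cvgr_to_le cn); near=> k; exact: gM.
have mlim e (S : measurableType e) (g : S -> R) (g_ : nat -> S -> R) :
    (forall k, measurable_fun setT (g_ k)) ->
    (forall w, g_ k w @[k --> \oo] --> g w) -> measurable_fun setT g.
  by move=> mg cg; apply: (measurable_fun_cvg mg) => w _; exact: cg.
have dct e (S : measurableType e) (Q : probability S R) (U : S -> 'cV[R]_n)
    (g : S -> R) (g_ : nat -> S -> R) t c :
    (forall i, measurable_fun setT (fun w => U w i 0)) ->
    (forall k, measurable_fun setT (g_ k)) ->
    (forall k w, `|g_ k w| <= M) ->
    (forall w, g_ k w @[k --> \oo] --> g w) ->
    (\int[Q]_w (g_ k w * sin (phase U t c w))%:E @[k --> \oo] -->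
     \int[Q]_w (g w * sin (phase U t c w))%:E)%E.
  move=> mU mg gM cg.
  have [] := @dominated_convergence _ S R Q setT measurableT
    (fun k w => (g_ k w * sin (phase U t c w))%:E)
    (fun w => (g w * sin (phase U t c w))%:E) (EFin \o cst M) => //.
  - move=> k; apply/measurable_EFinP.
    exact: measurable_funM (measurable_sin_phase _ _ _).
  - apply/measurable_EFinP.
    apply: measurable_funM (measurable_sin_phase _ _ _) => //.
    exact: mlim cg.
  - apply/aeW => w _; apply: cvg_EFin; first by near=> k.
    by apply: cvgMl; exact: cg.
  - apply: (@bounded_integrable _ _ _ _ _ `|M|) => //.
  - apply/aeW => w k _ /=; rewrite lee_fin -[leRHS]mulr1.
    exact: (bnd_mul (gM k) (fun w => sin_le1 (phase U t c w)) w).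
split.
- by apply: mlim cvh => k; case: (ag k).
- by apply: mlim cvh' => k; case: (ag k).
- by exists M; split; [exact: lim_bnd cvh|exact: lim_bnd cvh'].
move=> t c.
have mh k : measurable_fun setT (h_ k) by case: (ag k).
have mh' k : measurable_fun setT (h'_ k) by case: (ag k).
have c1 := @dct _ _ P V h h_ t c mV mh hM cvh.
have c2 := @dct _ _ P' V' h' h'_ t c mV' mh' hM' cvh'.
apply: (cvg_unique _ c1) => //; apply: cvg_trans c2.
by apply: near_eq_cvg; near=> k; case: (ag k) => _ _ _ ->.
Unshelve. all: by end_near. Qed.

(** The only use of [eq_proj]: without a further factor, the integrand depends on the single
    projection along [t]. *)
Let agree1 : agree (cst 1) (cst 1).
Proof.
split => //; first by exists 1; split=> w /=; rewrite normr1.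
move=> t c; under eq_integral do rewrite mul1r.
under [RHS]eq_integral do rewrite mul1r.
pose f x : \bar R := (sin (x + c))%:E.
have mf : measurable_fun setT f.
  apply/measurable_EFinP; apply: measurableT_comp.
    by apply: continuous_measurable_fun; exact: continuous_sin.
  exact: measurable_funD.
have mdot e (S : measurableType e) (U : S -> 'cV[R]_n)
    (mU : forall i, measurable_fun setT (fun w => U w i 0)) :
    measurable_fun setT (fun w => (t *m U w) 0 0).
  rewrite (_ : (fun w => _) = phase U t 0); first exact: measurable_phase.
  by apply/funext => w; rewrite /phase addr0.
apply: (eq_law_integral (mdot _ _ _ mV) (mdot _ _ _ mV') mf) => //.
- by apply: (@bounded_integrable _ _ _ _ _ 1) => //;
    exact: measurable_sin_phase.
- by apply: (@bounded_integrable _ _ _ _ _ 1) => //;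
    exact: measurable_sin_phase.
- by move=> A mA; exact: eq_proj.
Qed.

(** Agreement is not visibly stable under products of two agreeing pairs. Multipliers are, because
    they are quantified over all agreeing pairs: multiplying by a product is multiplying twice. *)
Let mult (m : T -> R) (m' : T' -> R) := forall h h', agree h h' ->
  agree (fun w => h w * m w) (fun w => h' w * m' w).

Let mult_lin a b m m' k k' : mult m m' -> mult k k' ->
  mult (fun w => a * m w + b * k w) (fun w => a * m' w + b * k' w).
Proof.
move=> mm kk h h' hh.
have E S (g u v : S -> R) : (fun w => g w * (a * u w + b * v w)) =
    fun w => a * (g w * u w) + b * (g w * v w).
  by apply/funext => w; ring.
by rewrite !E; apply: agree_lin; [exact: mm|exact: kk].
Qed.

Let mult_mul m m' k k' : mult m m' -> mult k k' ->
  mult (fun w => m w * k w) (fun w => m' w * k' w).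
Proof.
move=> mm kk h h' hh.
have E S (g u v : S -> R) : (fun w => g w * (u w * v w)) =
    fun w => g w * u w * v w by apply/funext => w; rewrite mulrA.
by rewrite !E; apply: kk; exact: mm.
Qed.

Let mult1 : mult (fun=> 1) (fun=> 1).
Proof.
move=> h h' hh.
have E S (g : S -> R) : (fun w => g w * 1) = g.
  by apply/funext => w; rewrite mulr1.
by rewrite !E.
Qed.

Let mult_affine a b m m' : mult m m' ->
  mult (fun w => a + b * m w) (fun w => a + b * m' w).
Proof. by move=> /(mult_lin a b mult1); rewrite mulr1. Qed.

Let mult_exp m m' k : mult m m' ->
  mult (fun w => m w ^+ k) (fun w => m' w ^+ k).
Proof.
move=> mm; elim: k => [|k IH]; first exact: mult1.
have E S (g : S -> R) : (fun w => g w ^+ k.+1) = fun w => g w * g w ^+ k.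
  by apply/funext => w; rewrite exprS.
by rewrite !E; exact: mult_mul.
Qed.

Let mult_lim (m_ : nat -> T -> R) (m'_ : nat -> T' -> R) m m' :
  (forall k, mult (m_ k) (m'_ k)) ->
  (forall k w, `|m_ k w| <= 1) -> (forall k w, `|m'_ k w| <= 1) ->
  (forall w, m_ k w @[k --> \oo] --> m w) ->
  (forall w, m'_ k w @[k --> \oo] --> m' w) -> mult m m'.
Proof.
move=> mm b b' cv cv' h h' hh; have [_ _ [M [hM hM']] _] := hh.
apply: (@agree_lim (fun k w => h w * m_ k w) (fun k w => h' w * m'_ k w)
   _ _ (M * 1)).
- by move=> k; exact: mm.
- by move=> k; exact: bnd_mul.
- by move=> k; exact: bnd_mul.
- by move=> w; apply: cvgMr; exact: cv.
- by move=> w; apply: cvgMr; exact: cv'.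
Qed.

Let bool_le1 (b : bool) : `|b%:R| <= 1 :> R.
Proof. by case: b; rewrite ?normr1 ?normr0. Qed.

Let mult_sin_lt0 t c : mult (fun w => (sin (phase V t c w) < 0)%R%:R)
                            (fun w => (sin (phase V' t c w) < 0)%R%:R).
Proof.
have ms := @agree_sin t c.
have nz : mult (fun w => (sin (phase V t c w) != 0)%R%:R)
               (fun w => (sin (phase V' t c w) != 0)%R%:R).
  apply: (@mult_lim (fun k w => 1 - (1 - sin (phase V t c w) ^+ 2) ^+ k)
    (fun k w => 1 - (1 - sin (phase V' t c w) ^+ 2) ^+ k)).
  - move=> k; have E S (g : S -> R) : (fun w => 1 - (1 - g w ^+ 2) ^+ k) =
        fun w => 1 + (-1) * (1 + (-1) * g w ^+ 2) ^+ k.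
      by apply/funext => w; rewrite !mulN1r.
    rewrite !E; apply: mult_affine; apply: mult_exp; apply: mult_affine.
    exact: mult_exp.
  - move=> k w; have := sin_le1 (phase V t c w).
    rewrite -(@ler_pXn2r _ 2)// ?nnegrE// expr1n real_normK ?num_real// => s1.
    rewrite ger0_norm ?gerBl ?subr_ge0 ?exprn_ge0 ?exprn_ile1 ?subr_ge0//.
    by rewrite gerBl sqr_ge0.
  - move=> k w; have := sin_le1 (phase V' t c w).
    rewrite -(@ler_pXn2r _ 2)// ?nnegrE// expr1n real_normK ?num_real// => s1.
    rewrite ger0_norm ?gerBl ?subr_ge0 ?exprn_ge0 ?exprn_ile1 ?subr_ge0//.
    by rewrite gerBl sqr_ge0.
  - by move=> w; exact: cvg_indic_neq0.
  - by move=> w; exact: cvg_indic_neq0.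
pose q S (U : S -> 'cV[R]_n) k w := (sin (phase U t c w) != 0)%R%:R *
  (1 - ((1 + sin (phase U t c w)) / 2) ^+ k) ^+ (2 ^ k).
have q_le1 S (U : S -> 'cV[R]_n) k w : `|q S U k w| <= 1.
  rewrite /q normrM -[leRHS]mulr1 ler_pM ?bool_le1//.
  have := sin_le1 (phase U t c w); rewrite ler_norml => /andP[s1 s2].
  rewrite normrX exprn_ile1// ger0_norm ?gerBl ?subr_ge0.
    by rewrite exprn_ge0//; lra.
  by rewrite exprn_ile1//; lra.
apply: (@mult_lim (q _ V) (q _ V')) => //.
- move=> k; apply: (mult_mul nz).
  have E S (g : S -> R) : (fun w => (1 - ((1 + g w) / 2) ^+ k) ^+ (2 ^ k)) =
      fun w => (1 + (-1) * (2^-1 + 2^-1 * g w) ^+ k) ^+ (2 ^ k).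
    apply/funext => w; rewrite mulN1r; congr ((1 - _ ^+ _) ^+ _); ring.
  rewrite !E; apply: mult_exp; apply: mult_affine; apply: mult_exp.
  exact: mult_affine.
- by move=> w; exact: cvg_indic_lt0.
- by move=> w; exact: cvg_indic_lt0.
Qed.

Let mult_halfspace (t : 'rV[R]_n) a : mult (fun w => ((t *m V w) 0 0 < a)%R%:R)
                              (fun w => ((t *m V' w) 0 0 < a)%R%:R).
Proof.
have E S (U : S -> 'cV[R]_n) (k : nat) w :
    phase U (k.+1%:R^-1 *: t) (- (k.+1%:R^-1 * a)) w =
    k.+1%:R^-1 * ((t *m U w) 0 0 - a).
  by rewrite /phase -scalemxAl [(k.+1%:R^-1 *: (t *m U w)) 0 0]mxE mulrBr.
pose m S (U : S -> 'cV[R]_n) (k : nat) w : R :=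
  (sin (phase U (k.+1%:R^-1 *: t) (- (k.+1%:R^-1 * a)) w) < 0)%R%:R.
apply: (@mult_lim (m _ V) (m _ V')); rewrite /m => //.
- move=> w; under eq_fun do rewrite E.
  by rewrite -subr_lt0; exact: cvg_indic_sin_lt0.
- move=> w; under eq_fun do rewrite E.
  by rewrite -subr_lt0; exact: cvg_indic_sin_lt0.
Qed.

(** Indicators of intersections are products of indicators, so stability of multipliers under
    products makes this class a sigma-algebra and not merely a Dynkin system. *)
Let mset (C : set 'cV[R]_n) := mult (\1_(V @^-1` C)) (\1_(V' @^-1` C)).

Let msetC C : mset C -> mset (~` C).
Proof.
move=> /(mult_affine 1 (-1)); rewrite /mset.
have E S (U : S -> 'cV[R]_n) : (fun w => 1 + (-1) * \1_(U @^-1` C) w) =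
    \1_(U @^-1` (~` C)) :> (S -> R).
  apply/funext => w; rewrite preimage_setC indicC indicE mulN1r.
  by case: (_ \in _); rewrite /= ?subrr ?subr0.
by rewrite !E.
Qed.

Let msetI C D : mset C -> mset D -> mset (C `&` D).
Proof.
move=> mC mD; have := mult_mul mC mD; rewrite /mset !preimage_setI !indicI.
exact.
Qed.

Let mset_sigma : sigma_algebra setT mset.
Proof.
have m0 : mset set0.
  rewrite -setCT; apply: msetC; rewrite /mset !preimage_setT !indicT.
  exact: mult1.
split => //; first by move=> C mC; rewrite setTD; exact: msetC.
(* At each point the indicators of the partial unions [G k] are eventually constant, so [mult_lim]
   passes from finite to countable unions. *)
move=> F mF; pose G k := \big[setU/set0]_(i < k) F i.
have mG k : mset (G k).
  rewrite /G; elim: k => [|k IH]; first by rewrite big_ord0.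
  rewrite big_ord_recr/= -[_ `|` _]setCK setCU; apply: msetC.
  by apply: msetI; apply: msetC.
have cvG S (U : S -> 'cV[R]_n) w : \1_(U @^-1` (G k)) w @[k --> \oo] -->
    (\1_(U @^-1` \bigcup_i F i) w : R).
  rewrite indicE; have [|nF] := boolP (w \in _).
    rewrite inE => -[i _ Fi]; apply: cvg_near_cst; near=> k.
    rewrite indicE mem_set//= /G -bigcup_mkord; exists i => //=.
    by near: k; exact: nbhs_infty_gt.
  apply: cvg_near_cst; near=> k; rewrite indicE memNset//= /G -bigcup_mkord.
  by move=> [i _ Fi]; move/negP: nF; apply; rewrite inE; exists i.
have b S (U : S -> 'cV[R]_n) k w : `|\1_(U @^-1` (G k)) w| <= 1 :> R.
  by rewrite indicE.
by apply: (mult_lim mG).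
Unshelve. all: by end_near. Qed.

Theorem cramer_wold (C : set 'cV[R]_n) :
  g_sigma_preimage (fun i (v : 'cV[R]_n) => v i 0) C ->
  P (V @^-1` C) = P' (V' @^-1` C).
Proof.
have coord_mset i A : measurable A -> mset [set v | A (v i 0)].
  pose D := [set A | mset [set v | A (v i 0)]].
  suff DE : (@RGenInftyO.G R).-sigma.-measurable `<=` D.
    by have /= := RGenInftyO.measurableE R => ME mA; apply: DE; rewrite -ME.
  apply: smallest_sub.
    have [m0 mD mU] := mset_sigma; split => //.
    - by move=> B mB; exact: mD mB.
    - by move=> F mF; exact: mU mF.
  move=> _ [a ->]; rewrite /D /mset.
  have E S (U : S -> 'cV[R]_n) :
      \1_(U @^-1` [set v | `]-oo, a[%classic (v i 0)]) =
      (fun w => (((delta_mx 0 i : 'rV[R]_n) *m U w) 0 0 < a)%R%:R)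
      :> (S -> R).
    apply/funext => w; rewrite indicE -rowE mxE; congr (nat_of_bool _)%:R.
    by apply/idP/idP; rewrite inE/= in_itv.
  by have := @mult_halfspace (delta_mx 0 i) a; rewrite -!E.
suff gen : g_sigma_preimage (fun i (v : 'cV[R]_n) => v i 0) `<=` mset.
  (* At [t = 0] and [c = pi / 2] the sine is 1, so the agreement obtained from the constant pair
     reads as equality of the two probabilities. It also provides measurability of the preimages. *)
  move=> /gen mC; have [m1 m2 _ /(_ 0 (pi / 2))] := mC _ _ agree1.
  have E S (U : S -> 'cV[R]_n) w : 1 * \1_(U @^-1` C) w *
      sin (phase U 0 (pi / 2) w) = \1_(U @^-1` C) w :> R.
    by rewrite /phase mul0mx mxE add0r sin_pihalf mulr1 mul1r.
  under eq_integral do rewrite E.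
  under [in RHS]eq_integral do rewrite E.
  have mE e (S : measurableType e) (U : S -> 'cV[R]_n) :
      measurable_fun setT (fun w => 1 * \1_(U @^-1` C) w : R) ->
      measurable (U @^-1` C).
    move=> /(_ measurableT [set 1] (measurable_set1 _)).
    congr measurable; rewrite setTI; apply/seteqP; split => w /=.
      by rewrite mul1r indicE; case: (boolP (_ \in _)) => [|_ /eqP];
        rewrite ?inE// eq_sym oner_eq0.
    by move=> Cw; rewrite indicE mem_set// mul1r.
  by rewrite !integral_indic ?setIT//; exact: mE.
apply: smallest_sub; first exact: mset_sigma.
rewrite -bigcup_seq => C' [i _ [A mA <-]].
by rewrite setTI; exact: coord_mset.
Qed.

End cramer_wold_theorem.

(** * Convolution of normal laws *)

Section affine_change.
Variable R : realType.
Notation mu := (@lebesgue_measure R).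

Lemma measurable_affine (m b : R) :
  measurable_fun setT (fun x : R => m + b * x).
Proof. by apply: measurable_funD => //; apply: measurable_funM. Qed.

Let affine (m b x : R) : R := m + b * x.

Let lebesgue_preimage_affine_itv_oc (m b c d : R) : b != 0 -> c < d ->
  (`|b|%:E * mu (affine m b @^-1` `]c, d]%classic) = (d - c)%:E)%E.
Proof.
move=> b0 cd; have [bneg|bpos|/eqP] := ltgtP b 0; last by rewrite (negbTE b0).
- rewrite (_ : _ @^-1` _ = `[(d - m) / b, (c - m) / b[%classic).
    rewrite lebesgue_measure_itv/= lte_fin ltr_nM2r ?invr_lt0// ltrD2r cd.
    by rewrite -EFinB -EFinM ltr0_norm//; congr EFin; field.
  apply/seteqP; split => x /=; rewrite /affine !in_itv/= ler_ndivrMr//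
    ltr_ndivlMr// lerBrDl ltrBlDl ![_ * b]mulrC => /andP[-> ->] //.
- rewrite (_ : _ @^-1` _ = `](c - m) / b, (d - m) / b]%classic).
    rewrite lebesgue_measure_itv/= lte_fin ltr_pM2r ?invr_gt0// ltrD2r cd.
    by rewrite -EFinB -EFinM gtr0_norm//; congr EFin; field.
  apply/seteqP; split => x /=; rewrite /affine !in_itv/= ler_pdivlMr//
    ltr_pdivrMr// lerBrDl ltrBlDl ![_ * b]mulrC => /andP[-> ->] //.
Qed.

(** The push-forward of Lebesgue measure under the affine map, scaled by [|b|], gives each interval
    []c, d]] its length; uniqueness identifies it with Lebesgue measure. *)
Lemma ge0_integral_affine (m b : R) (f : R -> \bar R) : b != 0 ->
  measurable_fun setT f -> (forall x, 0 <= f x)%E ->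
  (\int[mu]_y f y = `|b|%:E * \int[mu]_x f (m + b * x)%R)%E.
Proof.
move=> b0 mf f0.
pose aff : measurableTypeR R -> measurableTypeR R := affine m b.
have mA : measurable_fun setT aff by exact: measurable_affine.
pose nu : {measure set (measurableTypeR R) -> \bar R} :=
  mscale (NngNum (normr_ge0 b))
    (measure_function_pushforward__canonical__measure_function_Measure mu mA).
have muE A : measurable A -> mu A = nu A.
  apply: lebesgue_measure_unique => X /ocitvP[->|[[c d] /= cd ->]].
    by rewrite !measure0.
  rewrite lebesgue_measure_itv/= lte_fin cd -EFinB.
  by rewrite -(lebesgue_preimage_affine_itv_oc m b0 cd).
transitivity (\int[nu]_y f y)%E.
  by apply: eq_measure_integral => A mA' _; exact: muE.
rewrite ge0_integral_mscale//; congr (_ * _)%E.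
by rewrite ge0_integral_pushforward.
Qed.

End affine_change.

Section gaussian.
Variable R : realType.
Notation mu := (@lebesgue_measure R).
Notation std := (@normal_prob R 0 1).
Implicit Types (a b c m s x z : R) (A : set R).

Lemma normal_pdf_sqr m a c : a ^+ 2 = c ^+ 2 -> normal_pdf m a = normal_pdf m c.
Proof.
move=> ac; apply/funext => x; rewrite /normal_pdf /normal_peak /normal_fun ac.
by congr (if _ then _ else _); rewrite -(sqrf_eq0 a) ac sqrf_eq0.
Qed.

Lemma normal_pdf_affine m b x : b != 0 ->
  normal_pdf 0 1 x = `|b| * normal_pdf m b (m + b * x).
Proof.
move=> b0; rewrite !normal_pdfE ?oner_neq0// mulrA; congr (_ * _).
  rewrite /normal_peak expr1n mul1r -mulrnAr sqrtrM ?sqr_ge0// sqrtr_sqr invfM.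
  by rewrite mulVKf// normr_eq0.
by rewrite /normal_fun; congr expR; field.
Qed.

Lemma std_preimage_affine m b A : b != 0 -> measurable A ->
  std [set x | A (m + b * x)] = normal_prob m b A.
Proof.
move=> b0 mA; rewrite /normal_prob [LHS]integral_mkcond [RHS]integral_mkcond.
rewrite [RHS](@ge0_integral_affine _ m b)//; last 2 first.
- apply/(measurable_restrictT _ mA)/measurable_funTS/measurable_EFinP.
  exact: measurable_normal_pdf.
- by move=> x; rewrite patchE; case: ifP => //; rewrite lee_fin normal_pdf_ge0.
rewrite -ge0_integralZl//; last 2 first.
- apply: (@measurableT_comp _ _ _ _ _ _
    ((fun x => (normal_pdf m b x)%:E) \_ A)).
    apply/(measurable_restrictT _ mA)/measurable_funTS/measurable_EFinP.
    exact: measurable_normal_pdf.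
  exact: measurable_affine.
- by move=> x; rewrite patchE; case: ifP => //; rewrite lee_fin normal_pdf_ge0.
apply: eq_integral => x _; rewrite !patchE.
have -> : (x \in [set x | A (m + b * x)]) = (m + b * x \in A).
  by apply/idP/idP; rewrite !inE.
by case: ifP; rewrite ?mule0// -EFinM (normal_pdf_affine m _ b0).
Qed.

(** This form covers the Dirac mass too, since the map is constant for [v = 0]. Projections of a
    singular normal vector can then be handled like all others. *)
Lemma normal_lawE m v A : 0 <= v -> measurable A ->
  normal_law m v A = std [set x | A (m + Num.sqrt v * x)].
Proof.
move=> v0 mA; rewrite /normal_law; case: eqVneq => [->|v1].
  rewrite sqrtr0 diracE; have [Am|Am] := boolP (m \in A).
    rewrite (_ : [set x | _] = setT) ?probability_setT//.
    by apply/seteqP; split => x //= _; rewrite mul0r addr0 -in_setE.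
  rewrite (_ : [set x | _] = set0) ?measure0//.
  by apply/seteqP; split => x //=; rewrite mul0r addr0 -in_setE (negbTE Am).
by rewrite std_preimage_affine// sqrtr_eq0 -ltNge lt_def v1.
Qed.

(** The Radon-Nikodym derivative is known only through its integrals over measurable sets; comparing
    these identifies it with the density almost everywhere. *)
Lemma integral_normal_prob m s (f : R -> \bar R) :
  (normal_prob m s).-integrable setT f ->
  (\int[normal_prob m s]_x f x = \int[mu]_x (f x * (normal_pdf m s x)%:E))%E.
Proof.
move=> fi; have dom := normal_prob_dominates m s.
rewrite -(Radon_Nikodym_change_of_variables dom)//.
have mf := measurable_int _ fi.
apply: ae_eq_integral => //.
- by apply: emeasurable_funM => //; apply: measurable_int;
    exact: Radon_Nikodym_integrable.
- apply: emeasurable_funM => //; apply/measurable_EFinP.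
  exact: measurable_normal_pdf.
- apply: ae_eqe_mul2l => /=.
  rewrite Radon_NikodymE//=; case: cid => /= h [h1 h2 h3].
  apply: integral_ae_eq => //=.
  + by apply/measurable_EFinP; exact: measurable_normal_pdf.
  + by move=> E _ mE; rewrite -h3.
Qed.

(* Bayes' formula for a normal prior and a normal likelihood. *)
Lemma normal_pdf_bayes a b c x z : b != 0 -> c ^+ 2 = a ^+ 2 + b ^+ 2 ->
  normal_pdf 0 1 x * normal_pdf (a * x) b z =
  normal_pdf 0 c z * normal_pdf (a * z / c ^+ 2) (b / c) x.
Proof.
move=> b0 cE; have c0 : c != 0.
  rewrite -sqrf_eq0 cE gt_eqF// ltr_wpDl ?sqr_ge0//.
  by rewrite exprn_even_gt0.
have bc0 : b / c != 0 by rewrite mulf_neq0// invr_eq0.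
rewrite !normal_pdfE ?oner_neq0// mulrACA [RHS]mulrACA; congr (_ * _).
  have var_ge0 s : 0 <= s ^+ 2 * pi *+ 2 :> R.
    by rewrite mulrn_wge0// mulr_ge0 ?pi_ge0// sqr_ge0.
  rewrite /normal_peak -!invfM -!sqrtrM//.
  by congr (Num.sqrt _)^-1; field.
rewrite /normal_fun -!expRD; congr expR.
apply/eqP; rewrite -subr_eq0; apply/eqP.
(* The difference of the two exponents is a multiple of [c ^ 2 - (a ^ 2 + b ^ 2)]; exhibiting this
   factor isolates the single use of [cE]. *)
transitivity ((c ^+ 2 - (a ^+ 2 + b ^+ 2)) *
  ((c * x) ^+ 2 - z ^+ 2) / (2 * b ^+ 2 * c ^+ 2)); last first.
  by rewrite cE subrr !mul0r.
by field; rewrite c0 b0.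
Qed.

Lemma measurable_std_section a b A : measurable A ->
  measurable_fun setT (fun x => std [set y | A (a * x + b * y)]).
Proof.
move=> mA; pose S := [set xy : R * R | A (a * xy.1 + b * xy.2)].
have mS : measurable S.
  rewrite (_ : S = setT `&` (fun xy : R * R => a * xy.1 + b * xy.2) @^-1` A).
    have : measurable_fun setT (fun xy : R * R => a * xy.1 + b * xy.2).
      by apply: measurable_funD; apply: measurable_funM.
    exact.
  by rewrite setTI.
have := measurable_fun_xsection std mS; congr measurable_fun.
apply/funext => x /=.
rewrite (_ : xsection S x = [set y | A (a * x + b * y)])//.
by apply/seteqP; split => y; rewrite /xsection/= inE.
Qed.

Lemma std_section01 a b A x : measurable A ->
  (0 <= std [set y | A (a * x + b * y)%R] <= 1)%E.
Proof.
move=> mA; rewrite measure_ge0/= probability_le1//.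
rewrite -[X in measurable X]setTI.
have : measurable_fun setT (fun y : R => a * x + b * y).
  exact: measurable_affine.
exact.
Qed.


(** For [b != 0], Tonelli's theorem and [normal_pdf_bayes] allow integrating over [x] first: the
    posterior density has integral 1, and the density with scale [c] remains. For [b = 0] there is
    no likelihood density, and the inner probability is an indicator. *)
Lemma std_convolution a b c A : c ^+ 2 = a ^+ 2 + b ^+ 2 -> measurable A ->
  (\int[std]_x std [set y | A (a * x + b * y)%R] =
   std [set x | A (c * x)%R])%E.
Proof.
move=> cE mA.
have scale s B : s != 0 -> measurable B ->
    std [set x | B (s * x)] = normal_prob 0 s B.
  move=> s0 mB; rewrite -(std_preimage_affine 0 s0 mB).
  by under [in RHS]eq_set do rewrite add0r.
have [b0|b0] := eqVneq b 0.
  have mB : measurable [set x | A (a * x)].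
    rewrite -[X in measurable X]setTI.
    have : measurable_fun setT (fun x : R => a * x) by exact: measurable_funM.
    exact.
  transitivity (std [set x | A (a * x)]).
    transitivity (\int[std]_x (\1_[set x | A (a * x)%R] x)%:E)%E; last first.
      by rewrite integral_indic// setIT.
    apply: eq_integral => x _.
    rewrite indicE; have [/set_mem|/negP] := boolP (x \in _).
      move=> /= Ax; rewrite (_ : [set y | _] = setT) ?probability_setT//.
      by apply/seteqP; split => y //= _; rewrite b0 mul0r addr0.
    move=> Ax; rewrite (_ : [set y | _] = set0) ?measure0//.
    apply/seteqP; split => y //=; rewrite b0 mul0r addr0 => Aax.
    by apply: Ax; rewrite inE.
  (* Here [c] may be [- a]; the two laws still coincide because the density depends on the scale
     through its square. *)
  have ac : a ^+ 2 = c ^+ 2 by rewrite cE b0 expr0n addr0.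
  have [a0|a0] := eqVneq a 0.
    move/esym/eqP: ac; rewrite a0 expr0n/= sqrf_eq0 => /eqP ->.
    by under eq_set do rewrite mul0r.
  have c0 : c != 0 by rewrite -sqrf_eq0 -ac sqrf_eq0.
  by rewrite !scale// /normal_prob (normal_pdf_sqr _ ac).
have c0 : c != 0.
  by rewrite -sqrf_eq0 cE gt_eqF// ltr_wpDl ?sqr_ge0// exprn_even_gt0.
have mS := @measurable_std_section a b _ mA.
rewrite integral_normal_prob; last first.
  by apply: integrable_le1 => // x; exact: std_section01.
(* The likelihood is spelled out so that joint measurability in both variables can be checked factor
   by factor. *)
pose f (xz : R * R) : \bar R := (normal_pdf 0 1 xz.1 * (normal_peak b *
  expR (- (xz.2 - a * xz.1) ^+ 2 / (b ^+ 2 *+ 2)) * \1_A xz.2))%:E.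
have f0 xz : (0 <= f xz)%E.
  by rewrite lee_fin !mulr_ge0 ?normal_pdf_ge0 ?normal_peak_ge0 ?expR_ge0.
have mf : measurable_fun setT f.
  apply/measurable_EFinP; apply: measurable_funM.
    by apply: measurableT_comp; [exact: measurable_normal_pdf|].
  apply: measurable_funM; last first.
    by apply: measurableT_comp => //; exact: measurable_indic.
  apply: measurable_funM => //; apply: measurableT_comp => //.
  apply: measurable_funM => //; apply: measurableT_comp => //.
  apply: measurable_funX; apply: measurable_funB => //.
  exact: measurable_funM.
transitivity (\int[mu]_x \int[mu]_z f (x, z))%E.
  apply: eq_integral => x _.
  rewrite std_preimage_affine// muleC /normal_prob integral_mkcond.
  rewrite -ge0_integralZl//.
  - apply: eq_integral => z _; rewrite patchE /f/= indicE.
    case: ifP => _; last by rewrite !mulr0 mule0.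
    by rewrite mulr1 -EFinM [normal_pdf (a * x) b]normal_pdfE.
  - apply/(measurable_restrictT _ mA)/measurable_funTS/measurable_EFinP.
    exact: measurable_normal_pdf.
  - by move=> z _; rewrite patchE; case: ifP; rewrite ?lee_fin ?normal_pdf_ge0.
  - by rewrite lee_fin normal_pdf_ge0.
rewrite fubini_tonelli// scale// /normal_prob [RHS]integral_mkcond.
apply: eq_integral => z _.
transitivity (\int[mu]_x (((fun z => (normal_pdf 0 c z)%:E) \_ A) z *
    (normal_pdf (a * z / c ^+ 2) (b / c) x)%:E))%E.
  apply: eq_integral => x _; rewrite /f/= patchE indicE.
  case: ifP => _; last by rewrite !mulr0 mul0e.
  rewrite mulr1 -EFinM -(normal_pdf_bayes _ _ b0 cE).
  by rewrite [normal_pdf (a * x) b]normal_pdfE.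
rewrite ge0_integralZl//.
- by rewrite integral_normal_pdf mule1.
- by apply/measurable_EFinP; exact: measurable_normal_pdf.
- by move=> x _; rewrite lee_fin normal_pdf_ge0.
- by rewrite patchE; case: ifP; rewrite ?lee_fin ?normal_pdf_ge0.
Qed.

End gaussian.

(** * Convex functions and Jensen's inequality *)

Section convex_functions.
Variables (R : realType) (phi : R -> R).
Hypothesis cphi : convex_function [set: R^o] phi.

Lemma convex_functionE (x y t : R) : 0 <= t <= 1 ->
  phi (t * x + (1 - t) * y) <= t * phi x + (1 - t) * phi y.
Proof.
move=> /andP[t0 t1].
have := @cphi (Itv01 t0 t1) x y (mem_set I) (mem_set I).
by rewrite !convRE.
Qed.

Lemma convex_three_points (x c y : R) : x < c -> c < y ->
  (y - x) * phi c <= (y - c) * phi x + (c - x) * phi y.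
Proof.
move=> xc cy; have xy : 0 < y - x by rewrite subr_gt0 (lt_trans xc).
have t01 : 0 <= (y - c) / (y - x) <= 1.
  by rewrite divr_ge0 ?ler_pdivrMr//=; lra.
have := @convex_functionE x y _ t01.
rewrite (_ : _ * x + _ = c); last by field; rewrite gt_eqF.
rewrite -(ler_pM2l xy); congr (_ <= _).
by field; rewrite gt_eqF.
Qed.

(** The slope [s] is the supremum of the difference quotients to the left of [c], that is, the left
    derivative. Every quotient to the right bounds them from above. *)
Lemma convex_subgradient (c : R) :
  exists s, forall x, phi c + s * (x - c) <= phi x.
Proof.
pose S := [set (phi c - phi x) / (c - x) | x in [set x | x < c]].
have S0 : S !=set0.
  by exists ((phi c - phi (c - 1)) / (c - (c - 1))), (c - 1) => //=; lra.
have Sub y : c < y -> ubound S ((phi y - phi c) / (y - c)).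
  move=> cy _ [x /= xc <-]; rewrite ler_pdivrMr ?subr_gt0//.
  rewrite mulrAC ler_pdivlMr ?subr_gt0//.
  have := convex_three_points xc cy; lra.
have supS : has_sup S.
  by split => //; exists ((phi (c + 1) - phi c) / (c + 1 - c)); apply: Sub; lra.
exists (sup S) => x; have [xc|cx|->] := ltgtP x c;
  last by rewrite subrr mulr0 addr0.
- have : (phi c - phi x) / (c - x) <= sup S.
    by apply: sup_upper_bound => //; exists x.
  rewrite ler_pdivrMr ?subr_gt0//; lra.
- have : sup S <= (phi x - phi c) / (x - c) by apply: ge_sup => //; exact: Sub.
  rewrite ler_pdivlMr ?subr_gt0//; lra.
Qed.

(** Sublevel sets of a convex function are intervals. *)
Lemma measurable_convex : measurable_fun setT phi.
Proof.
apply: (measurability _ (RGenOInfty.measurableE R)) => // _ [_ [a ->] <-].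
have -> : setT `&` phi @^-1` `]a, +oo[%classic = ~` [set x | phi x <= a].
  apply/seteqP; split => x /=; rewrite in_itv/= andbT leNgt.
    by case=> _ ->.
  by move=> /negP; rewrite negbK.
apply: measurableC; apply: is_interval_measurable => x y /= xa ya.
move=> z /andP[xz zy].
move: xz; rewrite le_eqVlt => /predU1P[<-//|xz].
move: zy; rewrite le_eqVlt => /predU1P[->//|zy].
have xy : 0 < y - x by rewrite subr_gt0 (lt_trans xz).
rewrite -(ler_pM2l xy) (le_trans (convex_three_points xz zy))//.
apply: (@le_trans _ _ ((y - z) * a + (z - x) * a)).
  by rewrite lerD// ler_wpM2l// subr_ge0 ltW.
lra.
Qed.

(** The chord from 0 to 1 bounds [phi] above, a supporting line at 0 bounds it below. As
    probabilities lie in this interval, all integrands built from [phi] are bounded. *)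
Lemma convex_bounded01 : exists M, forall t, 0 <= t <= 1 -> `|phi t| <= M.
Proof.
have [s sE] := convex_subgradient 0.
exists (`|phi 0| + `|phi 1| + `|s|) => t t01; have /andP[t0 t1] := t01.
have := @convex_functionE 1 0 t t01; rewrite mulr1 mulr0 addr0.
have := sE t; rewrite subr0.
have le_id (u v : R) : 0 <= u -> u <= 1 -> u * v <= `|v| /\ - `|v| <= u * v.
  move=> u0 u1; have : `|u * v| <= `|v|.
    by rewrite normrM ger0_norm// ler_piMl.
  by rewrite ler_norml => /andP[].
have := le_id t s t0 t1; have := le_id t (phi 1) t0 t1.
have := le_id (1 - t) (phi 0); rewrite mulrC.
have := normr_ge0 s; have := normr_ge0 (phi 0); have := normr_ge0 (phi 1).
have := ler_norm (phi 0); have := ler_norm (- phi 0); rewrite normrN.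
move: (phi 0) (phi 1) (phi t) => p0 p1 pt.
rewrite ler_norml => *; apply/andP; split; lra.
Qed.

End convex_functions.

Section jensen.
Context d (T : measurableType d) (R : realType) (P : probability T R).

Lemma Rintegral_affine (g : T -> R) (M a b : R) :
  measurable_fun setT g -> (forall w, `|g w| <= M) ->
  \int[P]_w (a + b * g w) = a + b * \int[P]_w g w.
Proof.
move=> mg gM; have gi := bounded_integrable P mg gM.
rewrite RintegralD//; last first.
- apply: (@bounded_integrable _ _ _ _ _ (`|b| * M)).
    exact: measurable_funM.
  by move=> w; rewrite normrM ler_wpM2l.
- exact: finite_measure_integrable_cst.
rewrite RintegralZl//; congr (_ + _); transitivity (a * fine (P setT)).
  exact: Rintegral_cst.
by rewrite probability_setT mulr1.
Qed.

(** Integrate the supporting line of [phi] at the mean of [g]. *)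
Lemma jensen01 (phi : R -> R) (g : T -> R) :
  convex_function [set: R^o] phi -> measurable_fun setT g ->
  (forall w, 0 <= g w <= 1) ->
  phi (\int[P]_w g w) <= \int[P]_w phi (g w).
Proof.
move=> cphi mg g01; set c := \int[P]_w g w.
have [s sE] := convex_subgradient cphi c.
have g1 w : `|g w| <= 1 by have /andP[g0 g1] := g01 w; rewrite ger0_norm.
have [M phiM] := convex_bounded01 cphi.
have -> : phi c = \int[P]_w (phi c - s * c + s * g w).
  by rewrite (Rintegral_affine _ _ mg g1) -/c subrK.
apply: le_Rintegral => //.
- apply: (@bounded_integrable _ _ _ _ _ (`|phi c - s * c| + `|s|)).
    by apply: measurable_funD => //; exact: measurable_funM.
  move=> w; rewrite (le_trans (ler_normD _ _))// lerD2l normrM.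
  by rewrite ler_piMr.
- apply: (@bounded_integrable _ _ _ _ _ M); last by move=> w; exact: phiM.
  by apply: measurableT_comp mg; exact: measurable_convex.
- by move=> w _; rewrite (le_trans _ (sE _))//; lra.
Qed.

Lemma Rintegral_ge0_eq0 (f : T -> R) (M : R) : measurable_fun setT f ->
  (forall w, `|f w| <= M) -> (forall w, 0 <= f w) -> \int[P]_w f w = 0 ->
  {ae P, forall w, f w = 0}.
Proof.
move=> mf fM f0 If0; have mfE : measurable_fun setT (EFin \o f).
  exact/measurable_EFinP.
have : (\int[P]_w `|(EFin \o f) w|)%E = 0%E.
  under eq_integral do rewrite gee0_abs ?lee_fin//.
  rewrite -[LHS]fineK; first by congr EFin.
  exact/integrable_fin_num/(bounded_integrable P mf fM).
move=> /(ae_eq_integral_abs P measurableT mfE).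
by apply: filterS => w /(_ I) [].
Qed.

Lemma ae_eq_le_Rintegral (f g : T -> R) (M N : R) :
  measurable_fun setT f -> measurable_fun setT g ->
  (forall w, `|f w| <= M) -> (forall w, `|g w| <= N) ->
  (forall w, f w <= g w) -> \int[P]_w g w <= \int[P]_w f w ->
  {ae P, forall w, g w = f w}.
Proof.
move=> mf mg fM gN fg gf.
have fi := bounded_integrable P mf fM; have gi := bounded_integrable P mg gN.
have : {ae P, forall w, g w - f w = 0}.
  apply: (@Rintegral_ge0_eq0 _ (N + M)).
  - exact: measurable_funB.
  - by move=> w; rewrite (le_trans (ler_normB _ _))// lerD.
  - by move=> w; rewrite subr_ge0.
  rewrite RintegralB//; apply/eqP; rewrite subr_eq0 eq_le gf/=.
  exact: le_Rintegral.
by apply: filterS => w /eqP; rewrite subr_eq0 => /eqP.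
Qed.

(** The equality case of Jensen's inequality for the square: the variance of [g] vanishes. *)
Lemma sqr_Rintegral_eq (g : T -> R) : measurable_fun setT g ->
  (forall w, 0 <= g w <= 1) ->
  \int[P]_w (g w ^+ 2) = (\int[P]_w g w) ^+ 2 ->
  {ae P, forall w, g w = \int[P]_w g w}.
Proof.
move=> mg g01; set c := \int[P]_w g w => gE.
have g1 w : `|g w| <= 1 by have /andP[g0 g1] := g01 w; rewrite ger0_norm.
have mg2 : measurable_fun setT (fun w => g w ^+ 2) by exact: measurable_funX.
have g21 w : `|g w ^+ 2| <= 1 by rewrite normrX exprn_ile1.
have i1 := bounded_integrable P mg2 g21.
have m2 : measurable_fun setT (fun w => c ^+ 2 + (- (2 * c)) * g w).
  by apply: measurable_funD => //; exact: measurable_funM.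
have i2 : P.-integrable setT (EFin \o (fun w => c ^+ 2 + (- (2 * c)) * g w)).
  apply: (@bounded_integrable _ _ _ _ _ (`|c ^+ 2| + `|- (2 * c)|)) => //.
  move=> w; rewrite (le_trans (ler_normD _ _))// lerD2l normrM.
  by rewrite ler_piMr.
have : {ae P, forall w, (g w - c) ^+ 2 = 0}.
  apply: (@Rintegral_ge0_eq0 _ ((1 + `|c|) ^+ 2)).
  - by apply: measurable_funX; exact: measurable_funB.
  - move=> w; rewrite normrX ler_pXn2r ?nnegrE ?addr_ge0//.
    by rewrite (le_trans (ler_normB _ _))// lerD2r.
  - by move=> w; exact: sqr_ge0.
  transitivity (\int[P]_w (g w ^+ 2 + (c ^+ 2 + (- (2 * c)) * g w))).
    by apply: eq_Rintegral => w _; ring.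
  by rewrite RintegralD// (Rintegral_affine _ _ mg g1) gE -/c; ring.
by apply: filterS => w /eqP; rewrite sqrf_eq0 subr_eq0 => /eqP.
Qed.

Lemma ae_witness (A : set T) (Q : T -> Prop) : measurable A -> P A != 0%E ->
  {ae P, forall w, Q w} -> exists2 w, A w & Q w.
Proof.
move=> mA PA0 [N [mN N0 QN]]; apply: contrapT => nex.
move/eqP: PA0; apply; apply/eqP; rewrite -measure_le0 -N0 le_measure ?inE//.
by move=> w Aw; apply: QN => /= Qw; apply: nex; exists w.
Qed.

End jensen.

Section fubini_bounded.
Context d1 d2 (T1 : measurableType d1) (T2 : measurableType d2) (R : realType).
Variables (P1 : probability T1 R) (P2 : probability T2 R).
Variables (g : T1 * T2 -> R) (M : R).
Hypotheses (mg : measurable_fun setT g) (gM : forall xy, `|g xy| <= M).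

Let gi : (P1 \x P2)%E.-integrable setT (EFin \o g).
Proof. exact: bounded_integrable. Qed.

Let mg2 x : measurable_fun setT (fun y => g (x, y)).
Proof. by apply: measurableT_comp mg _; exact: measurable_pair1. Qed.

Let EFin_section x : (\int[P2]_y g (x, y))%:E = (\int[P2]_y (g (x, y))%:E)%E.
Proof.
rewrite fineK//; apply: integrable_fin_num => //.
by apply: (@bounded_integrable _ _ _ _ _ M).
Qed.

Lemma measurable_Rintegral_section :
  measurable_fun setT (fun x => \int[P2]_y g (x, y)).
Proof.
apply/measurable_EFinP; have := measurable_fubini_F gi.
by congr measurable_fun; apply/funext => x /=; rewrite EFin_section.
Qed.

Lemma normr_Rintegral_section_le x : `|\int[P2]_y g (x, y)| <= M.
Proof.
rewrite (le_trans (le_normr_Rintegral _ _))//.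
  by apply: (@bounded_integrable _ _ _ _ _ M).
rewrite -[leRHS]mulr1 -[X in _ * X]/(fine 1%E) -(probability_setT P2).
rewrite -Rintegral_cst//; apply: le_Rintegral => //.
- apply: (@bounded_integrable _ _ _ _ _ M); first exact: measurableT_comp.
  by move=> y; rewrite normr_id.
- exact: finite_measure_integrable_cst.
Qed.

Lemma Rintegral_prod :
  \int[(P1 \x P2)%E]_xy g xy = \int[P1]_x \int[P2]_y g (x, y).
Proof.
rewrite /Rintegral -integral12_prod_meas1//; congr fine.
by apply: eq_integral => x _; have := EFin_section x; rewrite /Rintegral => ->.
Qed.

End fubini_bounded.

(** * Tail probabilities in the normal regression model *)

Section normal_regression.
Variable R : realType.
Notation std := (@normal_prob R 0 1).
Implicit Types (s z u r : R).

(** The conditional probability of exceeding [z] when the prediction is [u] and the noise has scale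
    [s]. For [s = 0] it degenerates to the indicator of [z <= u]. *)
Definition std_tail s z u : R := fine (std [set c | z <= u + s * c]).

Let measurable_tail_set s z u : measurable [set c : R | z <= u + s * c].
Proof.
rewrite (_ : [set c | _] = (fun c => u + s * c) @^-1` `[z, +oo[%classic).
  by rewrite -[X in measurable X]setTI; exact: measurable_affine.
by apply/seteqP; split => c /=; rewrite in_itv/= andbT.
Qed.

Lemma EFin_std_tail s z u : (std_tail s z u)%:E = std [set c | z <= u + s * c].
Proof.
by rewrite fineK//; apply: fin_num_measure; exact: measurable_tail_set.
Qed.

Lemma std_tail01 s z u : 0 <= std_tail s z u <= 1.
Proof.
rewrite -!lee_fin EFin_std_tail; apply/andP; split; first exact: measure_ge0.
by apply: probability_le1; exact: measurable_tail_set.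
Qed.

Let std_tail_le1 s z u : `|std_tail s z u| <= 1.
Proof. by have /andP[t0 t1] := std_tail01 s z u; rewrite ger0_norm. Qed.

Lemma measurable_std_tail s z : measurable_fun setT (std_tail s z).
Proof.
apply/measurable_EFinP.
have := @measurable_std_section _ 1 s `[z, +oo[%classic.
move=> /(_ (measurable_itv _)); congr measurable_fun; apply/funext => u /=.
rewrite EFin_std_tail; congr (normal_prob 0 1 _).
by apply/seteqP; split => c /=; rewrite in_itv/= andbT mul1r.
Qed.

(** Noise of scale [c] is split into independent parts of scales [a] and [b], the first of which is
    averaged out. *)
Lemma std_tail_convolution a b c z u : c ^+ 2 = a ^+ 2 + b ^+ 2 ->
  std_tail c z u = \int[std]_y std_tail b z (u + a * y).
Proof.
move=> cE; rewrite /Rintegral/std_tail; congr fine.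
have mA : measurable [set w : R | z <= u + 1 * w] by exact: measurable_tail_set.
have := std_convolution cE mA.
rewrite (_ : [set x | [set w | z <= u + 1 * w] (c * x)] =
  [set x | z <= u + c * x]); last first.
  by apply/seteqP; split => x /=; rewrite mul1r.
move=> <-; apply: eq_integral => x _; rewrite EFin_std_tail.
congr (normal_prob 0 1 _).
by apply/seteqP; split => y /=; rewrite mul1r addrA.
Qed.

Lemma measurable_tail_pair s z a b :
  measurable_fun setT (fun xy : R * R => std_tail s z (a * xy.1 + b * xy.2)).
Proof.
apply: measurableT_comp; first exact: measurable_std_tail.
by apply: measurable_funD; apply: measurable_funM.
Qed.

(* [E phi (P (Y >= z | X))] for a standard normal [Y] whose explained ratio
   given [X] is [r]. *)
Definition tail_functional (phi : R -> R) z r : R :=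
  \int[std]_x phi (std_tail (Num.sqrt (1 - r)) z (Num.sqrt r * x)).

(** * Monotonicity in the explained ratio *)

Section comparison.
Variables (phi : R -> R) (z r r' : R).
Hypothesis cphi : convex_function [set: R^o] phi.
Hypotheses (r0 : 0 <= r) (rr' : r <= r') (r'1 : r' <= 1).
Let d := Num.sqrt (r' - r).
Let s' := Num.sqrt (1 - r').
(** As [d ^ 2 = r' - r], the prediction has variance [r'], so [g] models the conditional probability
    at ratio [r']. Averaging over the second variable returns [d y] to the noise and leaves the
    ratio [r]. *)
Let g (xy : R * R) : R := std_tail s' z (Num.sqrt r * xy.1 + d * xy.2).

Let measurable_g : measurable_fun setT g.
Proof. exact: measurable_tail_pair. Qed.

Let measurable_gx x : measurable_fun setT (fun y => g (x, y)).
Proof. by apply: measurableT_comp measurable_g _; exact: measurable_pair1. Qed.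

Let measurable_phig : measurable_fun setT (phi \o g).
Proof. exact: measurableT_comp (measurable_convex cphi) measurable_g. Qed.

Lemma tail_functional_outer : tail_functional phi z r' =
  \int[std]_x \int[std]_y phi (g (x, y)).
Proof.
have [M phiM] := convex_bounded01 cphi.
have gM xy : `|phi (g xy)| <= M by rewrite phiM// std_tail01.
rewrite -(Rintegral_prod std std measurable_phig gM).
rewrite /tail_functional /Rintegral.
congr fine.
pose f u : \bar R := (phi (std_tail s' z u))%:E.
have mphik : measurable_fun setT (fun u => phi (std_tail s' z u)).
  exact: measurableT_comp (measurable_convex cphi) (measurable_std_tail _ _).
have mf : measurable_fun setT f by exact/measurable_EFinP.
have m1 : measurable_fun setT (fun x : R => Num.sqrt r' * x).
  exact: measurable_funM.
have m2 : measurable_fun setT (fun xy : R * R => Num.sqrt r * xy.1 + d * xy.2).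
  by apply: measurable_funD; apply: measurable_funM.
pose Q : probability (measurableTypeR R * measurableTypeR R)%type R :=
  (std \x std)%E.
have := @eq_law_integral _ _ _ _ _ _ _ std Q _ _ _ m1 m2 mf; apply.
- apply: (@bounded_integrable _ _ _ _ _ M).
    exact: (measurableT_comp mphik m1).
  by move=> x; rewrite phiM// std_tail01.
- apply: (@bounded_integrable _ _ _ _ _ M).
    exact: (measurableT_comp mphik m2).
  by move=> x; rewrite phiM// std_tail01.
move=> A mA; rewrite /product_measure1.
have cE : Num.sqrt r' ^+ 2 = Num.sqrt r ^+ 2 + d ^+ 2.
  rewrite /d !sqr_sqrtr ?subr_ge0//; first by rewrite addrC subrK.
  exact: le_trans rr'.
rewrite -[LHS](std_convolution cE mA); apply: eq_integral => x _ /=.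
congr (normal_prob 0 1 _).
by apply/seteqP; split => y; rewrite /xsection/= inE.
Qed.

Lemma std_tail_section x : std_tail (Num.sqrt (1 - r)) z (Num.sqrt r * x) =
  \int[std]_y g (x, y).
Proof.
apply: std_tail_convolution; rewrite /d /s' !sqr_sqrtr ?subr_ge0//.
  by ring.
exact: le_trans r'1.
Qed.

Lemma le_tail_functional : tail_functional phi z r <= tail_functional phi z r'.
Proof.
have [M phiM] := convex_bounded01 cphi.
have gM xy : `|phi (g xy)| <= M by rewrite phiM// std_tail01.
rewrite tail_functional_outer; apply: le_Rintegral => //.
- apply: (@bounded_integrable _ _ _ _ _ M).
    apply: measurableT_comp (measurable_convex cphi) _.
    apply: measurableT_comp; first exact: measurable_std_tail.
    exact: measurable_funM.
  by move=> x; rewrite phiM// std_tail01.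
- apply: (@bounded_integrable _ _ _ _ _ M).
    exact: (measurable_Rintegral_section std std measurable_phig gM).
  by move=> x; exact: (normr_Rintegral_section_le std measurable_phig gM).
- move=> x _; rewrite std_tail_section.
  apply: (@jensen01 _ _ _ std phi _ cphi (measurable_gx x)) => y.
  exact: std_tail01.
Qed.

End comparison.

(** * Strict monotonicity for the square *)

Lemma convex_sqr : convex_function [set: R^o] (fun x : R => x ^+ 2).
Proof.
have H (a x y : R) : 0 <= a -> a <= 1 ->
    (a * x + (1 - a) * y) ^+ 2 <= a * x ^+ 2 + (1 - a) * y ^+ 2.
  move=> a0 a1; rewrite -subr_ge0.
  rewrite (_ : _ - _ = a * (1 - a) * (x - y) ^+ 2); last by ring.
  by rewrite mulr_ge0 ?sqr_ge0// mulr_ge0 ?subr_ge0.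
by move=> t x y _ _; rewrite !convRE; apply: H.
Qed.

Lemma std_gt0 a : std `[a, (a + 1)%R]%classic != 0%E.
Proof.
(* [M] bounds [|x|] on the interval, so the density is there at least its value at [M]. *)
pose M := `|a| + 1.
have lb x : `[a, a + 1]%classic x ->
    normal_peak 1 * expR (- M ^+ 2 / 2) <= normal_pdf 0 1 x.
  rewrite /= in_itv/= => /andP[ax xa]; rewrite normal_pdfE ?oner_neq0//.
  rewrite ler_wpM2l ?normal_peak_ge0// /normal_fun ler_expR subr0 expr1n !mulNr.
  rewrite lerN2 ler_pM2r ?invr_gt0// -[x ^+ 2]real_normK ?num_real//.
  rewrite lerXn2r ?nnegrE ?addr_ge0// ler_norml /M; apply/andP; split.
    by have := lerNnormlW (lexx `|a|); lra.
  by have := ler_norm a; lra.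
rewrite gt_eqF//; apply: (@lt_le_trans _ _
  (\int[lebesgue_measure]_(x in `[a, (a + 1)%R]%classic)
     (cst (normal_peak 1 * expR (- M ^+ 2 / 2))%:E x))%E).
  rewrite integral_cst//= lebesgue_measure_itv/= lte_fin ltrDl ltr01.
  rewrite -EFinB -EFinM lte_fin addrAC subrr add0r mulr1.
  by rewrite mulr_gt0 ?normal_peak_gt0 ?expR_gt0 ?oner_neq0.
apply: ge0_le_integral => //.
- by move=> x _; rewrite lee_fin mulr_ge0 ?normal_peak_ge0 ?expR_ge0.
- apply/measurable_funTS/measurable_EFinP; exact: measurable_normal_pdf.
Qed.

(** Any level above 1/2 would serve: it has to keep the lower bound 3/4 in [std_tail_ge] apart from
    the upper bound 1/4 in [std_tail_le]. *)
Lemma std_concentrated :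
  exists K : R, ((3 / 4)%:E < std `[(- K)%R, K]%classic)%E.
Proof.
pose F (n : nat) := `[- n%:R, n%:R : R]%classic.
have : std \o F @ \oo --> std (\bigcup_n F n).
  apply: nondecreasing_cvg_mu.
  - by move=> n; exact: measurable_itv.
  - by apply: bigcup_measurable => n _; exact: measurable_itv.
  - move=> m n mn; apply/subsetPset => x.
    rewrite /F/= !in_itv/= => /andP[mx xm].
    have : m%:R <= n%:R :> R by rewrite ler_nat.
    by move=> mn'; apply/andP; split; lra.
have -> : \bigcup_n F n = setT.
  apply/seteqP; split => // x _; exists (Num.truncn `|x|).+1 => //.
  by rewrite /F/= in_itv/= -ler_norml ltW// truncnS_gt.
rewrite probability_setT => /fine_cvg /(cvgr_gt _) /(_ (3 / 4)).
have lt1 : 3 / 4 < 1 :> R by lra.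
move=> /(_ lt1)[N _ /(_ N (leqnn N)) /= FN]; exists N%:R.
by rewrite -(@fineK _ (std _)) ?lte_fin//; exact: fin_num_measure.
Qed.

Lemma std_tail_ge K s z u :
  0 <= s -> ((3 / 4)%:E < std `[(- K)%R, K]%classic)%E ->
  z + s * K <= u -> 3 / 4 <= std_tail s z u.
Proof.
move=> s0 KP zu; rewrite -lee_fin EFin_std_tail (le_trans (ltW KP))//.
apply: le_measure; rewrite ?inE//; first exact: measurable_tail_set.
move=> c /=; rewrite in_itv/= => /andP[c1 _].
by have := ler_wpM2l s0 c1; rewrite mulrN; lra.
Qed.

Lemma std_tail_le K s z u :
  0 <= s -> ((3 / 4)%:E < std `[(- K)%R, K]%classic)%E ->
  u < z - s * K -> std_tail s z u <= 1 / 4.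
Proof.
set I := `[_, _]%classic; move=> s0 KP zu; rewrite -lee_fin EFin_std_tail.
have : (std [set c | (z <= u + s * c)%R] <= std (~` I))%E.
  apply: le_measure; rewrite ?inE//; first exact: measurable_tail_set.
    by apply: measurableC; exact: measurable_itv.
  move=> c /= zc; rewrite /I/= in_itv/= => /andP[_ cK].
  by have := ler_wpM2l s0 cK; lra.
move=> /le_trans; apply.
have mI : measurable I by exact: measurable_itv.
have fK : std I \is a fin_num by exact: fin_num_measure.
have -> : std (~` I) = (1 - fine (std I))%:E.
  by rewrite EFinB fineK//; exact: probability_setC.
by move: KP; rewrite -(fineK fK) lte_fin lee_fin; lra.
Qed.

(* Equality in Jensen's inequality would make [std_tail] constant almost
   everywhere, although it tends to 0 at -oo and to 1 at +oo. *)
Lemma lt_tail_functional_sqr z r r' : 0 <= r -> r < r' -> r' <= 1 ->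
  tail_functional (fun x => x ^+ 2) z r <
  tail_functional (fun x => x ^+ 2) z r'.
Proof.
move=> r0 rr' r'1; rewrite ltNge; apply/negP => le'.
pose d := Num.sqrt (r' - r); pose s' := Num.sqrt (1 - r').
have d0 : 0 < d by rewrite sqrtr_gt0 subr_gt0.
have s'0 : 0 <= s' by exact: sqrtr_ge0.
pose g (xy : measurableTypeR R * measurableTypeR R) : R :=
  std_tail s' z (Num.sqrt r * xy.1 + d * xy.2).
have mg : measurable_fun setT g by exact: measurable_tail_pair.
have g1 xy : `|g xy| <= 1 by exact: std_tail_le1.
have mg2 : measurable_fun setT (fun xy => g xy ^+ 2) by exact: measurable_funX.
have g21 xy : `|g xy ^+ 2| <= 1 by rewrite normrX exprn_ile1.
pose G1 x := \int[std]_y g (x, y).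
pose G2 x := \int[std]_y (g (x, y) ^+ 2).
have mG1 : measurable_fun setT G1 := measurable_Rintegral_section std std mg g1.
have mG2 : measurable_fun setT G2 :=
  measurable_Rintegral_section std std mg2 g21.
have G1b x : `|G1 x| <= 1 := normr_Rintegral_section_le std mg g1 x.
have G2b x : `|G2 x| <= 1 := normr_Rintegral_section_le std mg2 g21 x.
have G12 x : G1 x ^+ 2 <= G2 x.
  apply: (@jensen01 _ _ _ std (fun x => x ^+ 2) (fun y => g (x, y))).
  - exact: convex_sqr.
  - by apply: measurableT_comp mg _; exact: measurable_pair1.
  - by move=> y; exact: std_tail01.
have tailE : tail_functional (fun x => x ^+ 2) z r = \int[std]_x (G1 x ^+ 2).
  by apply: eq_Rintegral => x _; rewrite (std_tail_section z (ltW rr') r'1).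
have tailE' : tail_functional (fun x => x ^+ 2) z r' = \int[std]_x G2 x.
  exact: (tail_functional_outer z convex_sqr r0 (ltW rr')).
have mG12 : measurable_fun setT (fun x => G1 x ^+ 2) by exact: measurable_funX.
have G12b x : `|G1 x ^+ 2| <= 1 by rewrite normrX exprn_ile1.
rewrite tailE tailE' in le'.
have std1 : std setT != 0%E by rewrite probability_setT.
(* Pointwise [G1 ^ 2 <= G2], while the integrals are ordered the other way; so equality holds almost
   everywhere, and one such [x] is enough. *)
have /(ae_witness measurableT std1)[x _ G12x] :=
  ae_eq_le_Rintegral mG12 mG2 G12b G2b G12 le'.
have : {ae std, forall y, g (x, y) = G1 x}.
  apply: (@sqr_Rintegral_eq _ _ _ std (fun y => g (x, y)) _ _ G12x).
  - by apply: measurableT_comp mg _; exact: measurable_pair1.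
  - by move=> y; exact: std_tail01.
have [K KP] := std_concentrated => aeg.
pose u y := Num.sqrt r * x + d * y.
(* On the unit interval from [y1] the prediction [u] is at least [z + s' K]. The offset 2 in [y0]
   exceeds the interval length 1, so on the interval from [y0] it stays strictly below
   [z - s' K]. *)
pose y1 := (z + s' * K - Num.sqrt r * x) / d.
pose y0 := (z - s' * K - Num.sqrt r * x) / d - 2.
have [y] :=
  @ae_witness _ _ _ std `[y1, y1 + 1]%classic _
    (measurable_itv _) (std_gt0 y1) aeg.
rewrite /= in_itv/= => /andP[y1y _] gy.
have zy : z + s' * K <= u y.
  by move: y1y; clear -d0; rewrite /y1 /u ler_pdivrMr// mulrC; lra.
have [y'] :=
  @ae_witness _ _ _ std `[y0, y0 + 1]%classic _
    (measurable_itv _) (std_gt0 y0) aeg.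
rewrite /= in_itv/= => /andP[_ yy0] gy'.
have zy' : u y' < z - s' * K.
  have : y' < (z - s' * K - Num.sqrt r * x) / d.
    by apply: (le_lt_trans yy0); clear; rewrite /y0; lra.
  by clear -d0; rewrite ltr_pdivlMr// /u mulrC; lra.
have h1 := std_tail_ge s'0 KP zy; have h2 := std_tail_le s'0 KP zy'.
have : g (x, y) = g (x, y') by rewrite gy gy'.
rewrite /g/= -/(u y) -/(u y') => e.
by move: h1 h2; rewrite e; clear; lra.
Qed.

End normal_regression.

(** * Blocks of a covariance matrix *)

Section covariance_blocks.
Variables (R : realType) (p : nat) (Sigma : 'M[R]_(1 + p)) (G : 'M[R]_p).
Hypothesis Sigma_sym : Sigma^T = Sigma.
Hypothesis Sigma_psd : forall t : 'rV[R]_(1 + p), 0 <= (t *m Sigma *m t^T) 0 0.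
Hypothesis SigmaG : ginverse (drsubmx Sigma) G.

Let S := drsubmx Sigma.
Let cYX := ursubmx Sigma.
Let var := ulsubmx Sigma 0 0.

Lemma dlsubmx_sym : dlsubmx Sigma = cYX^T.
Proof. by rewrite /cYX -[in RHS]Sigma_sym -trmx_dlsub trmxK. Qed.

Lemma drsubmx_sym : S^T = S.
Proof. by rewrite /S trmx_drsub Sigma_sym. Qed.

Let entryD (A B : 'M[R]_1) : (A + B) 0 0 = A 0 0 + B 0 0.
Proof. by rewrite mxE. Qed.

Let entryZ k (A : 'M[R]_1) : (k *: A) 0 0 = k * A 0 0.
Proof. by rewrite mxE. Qed.

Let entryT (A : 'M[R]_1) : A^T 0 0 = A 0 0.
Proof. by rewrite mxE. Qed.

Let entry0 : (0 : 'M[R]_1) 0 0 = 0.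
Proof. by rewrite mxE. Qed.

Lemma quadratic_form_row (a : R) (u : 'rV[R]_p) :
  (row_mx a%:M u *m Sigma *m (row_mx a%:M u)^T) 0 0 =
  a ^+ 2 * var + 2 * a * (cYX *m u^T) 0 0 + (u *m S *m u^T) 0 0.
Proof.
rewrite -[X in _ *m X *m _]submxK mul_row_block tr_row_mx mul_row_col.
rewrite tr_scalar_mx !mulmxDl !mul_scalar_mx !mul_mx_scalar.
rewrite dlsubmx_sym -/S -/cYX.
have E : (u *m cYX^T) 0 0 = (cYX *m u^T) 0 0.
  by rewrite -[RHS]entryT trmx_mul trmxK.
by rewrite -!scalemxAl !(entryD, entryZ) E -/var; ring.
Qed.

(** A combination of the components of $X$ with variance 0 is uncorrelated with $Y$: otherwise
    [a ^ 2 * var + 2 * a * k] would be negative for small [a] of sign opposite to [k]. *)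
Lemma psd_kernel (u : 'rV[R]_p) : u *m S = 0 -> (cYX *m u^T) 0 0 = 0.
Proof.
move=> uS; set k := (cYX *m u^T) 0 0.
have q a : 0 <= a ^+ 2 * var + 2 * a * k.
  by have := Sigma_psd (row_mx a%:M u); rewrite quadratic_form_row uS mul0mx
    [X in _ + X]mxE addr0.
have var0 : 0 <= var.
  by have := q 1; have := q (-1); rewrite sqrrN expr1n; lra.
apply/eqP; apply: contrapT => /negP k0.
(* The denominator [var + 1] keeps this choice valid when [var] is 0. *)
have := q (- k / (var + 1)).
rewrite -(@pmulr_rge0 _ ((var + 1) ^+ 2)); last first.
  by rewrite exprn_gt0// ltr_wpDl.
rewrite [X in 0 <= X](_ : _ = - k ^+ 2 * (var + 2)); last first.
  by field; rewrite gt_eqF// ltr_wpDl.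
rewrite mulNr oppr_ge0 leNgt mulr_gt0//; last by lra.
by rewrite exprn_even_gt0.
Qed.

Definition regression_coef : 'rV[R]_p := ursubmx Sigma *m G.

Let b := regression_coef.

(** The normal equations. The columns of $1-GS$ lie in the kernel of $S$, where the covariance
    vector vanishes by [psd_kernel], so $c_{YX}GS=c_{YX}$. *)
Lemma regression_coef_mul : b *m S = cYX.
Proof.
apply/eqP; rewrite -subr_eq0; apply/eqP/rowP => j; rewrite [RHS]mxE.
pose u := (delta_mx 0 j : 'rV[R]_p) *m (1%:M - G *m S)^T.
have uS : u *m S = 0.
  apply: trmx_inj; rewrite trmx0 /u !trmx_mul trmxK drsubmx_sym mulmxA.
  by rewrite mulmxBr mulmx1 mulmxA SigmaG subrr mul0mx.
have := psd_kernel uS; rewrite /u trmx_mul trmxK mulmxA mulmxBr mulmx1 mulmxA.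
rewrite -/b trmx_delta => h.
rewrite -[LHS]opprK; apply/eqP; rewrite oppr_eq0; apply/eqP.
by rewrite -[RHS]h -colE !mxE opprB addrC.
Qed.

Let r := explained_ratio Sigma G.
Hypothesis var_neq0 : var != 0.

(** The right-hand side is the variance of the linear predictor $bX$. *)
Lemma explained_ratioE : r * var = (b *m S *m b^T) 0 0.
Proof.
rewrite regression_coef_mul /r /explained_ratio divfK// dlsubmx_sym -/cYX -/b.
by rewrite -[LHS]entryT trmx_mul trmxK.
Qed.

Lemma var_gt0 : 0 < var.
Proof.
have := Sigma_psd (row_mx 1%:M 0).
rewrite quadratic_form_row trmx0 mulmx0 mul0mx.
rewrite mul0mx entry0 expr1n mul1r mulr0 !addr0 => v0.
by rewrite lt_def var_neq0.
Qed.

(** Both bounds say that a variance is nonnegative: that of the predictor $bX$ and that of the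
    residual $bX-Y$. *)
Lemma explained_ratio01 : 0 <= r <= 1.
Proof.
have v0 := var_gt0.
have := Sigma_psd (row_mx 0%:M b); have := Sigma_psd (row_mx (-1)%:M b).
rewrite !quadratic_form_row -regression_coef_mul -/b -explained_ratioE.
rewrite sqrrN expr1n expr0n/= mulr0 !mul0r !add0r => h1 h0; apply/andP; split.
  rewrite -(pmulr_lge0 _ v0); lra.
rewrite -(ler_pM2r v0); lra.
Qed.

(** Write $aY+uX=(ab+u)X+a(Y-bX)$; the two terms are uncorrelated by the normal equations. *)
Lemma quadratic_form_residual (a : R) (u : 'rV[R]_p) :
  (row_mx a%:M u *m Sigma *m (row_mx a%:M u)^T) 0 0 =
  ((a *: b + u) *m S *m (a *: b + u)^T) 0 0 + a ^+ 2 * (var * (1 - r)).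
Proof.
rewrite quadratic_form_row linearD/= linearZ/= !mulmxDl !mulmxDr -!scalemxAl.
rewrite -!scalemxAr regression_coef_mul.
have E : (u *m S *m b^T) 0 0 = (cYX *m u^T) 0 0.
  rewrite -[LHS]entryT [(u *m S *m b^T)^T]trmx_mul [(u *m S)^T]trmx_mul trmxK.
  by rewrite drsubmx_sym mulmxA regression_coef_mul.
have E' : (cYX *m b^T) 0 0 = r * var.
  by rewrite explained_ratioE regression_coef_mul.
by rewrite !(entryD, entryZ) E E'; ring.
Qed.

End covariance_blocks.

(** * Conditional probabilities and quantiles *)

Section cond_prob.
Context d d' (T : measurableType d) (E : measurableType d') (R : realType).
Variables (P : probability T R) (X : {RV P >-> E}) (A : set T).

Lemma g_sigma_algebra_preimage_sub (B : set T) :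
  g_sigma_algebra_preimage X B -> measurable B.
Proof. by case=> C mC <-; exact: measurable_funP. Qed.

Lemma g_sigma_algebra_preimage_measurable_fun e (S : measurableType e)
    (f : T -> S) :
  measurable_fun [set: g_sigma_algebra_preimageType X] f ->
  measurable_fun setT f.
Proof.
move=> mf mT B mB; apply: g_sigma_algebra_preimage_sub; exact: (mf measurableT).
Qed.

(** The set where one version is smaller than the other belongs to the sigma-algebra of [X]; both
    have the same integral over it, so it is null. *)
Lemma cond_prob_version_unique (f g : T -> R) :
  cond_prob_version X A f -> cond_prob_version X A g ->
  {ae P, forall w, f w = g w}.
Proof.
move=> vf vg.
have null (u v : T -> R) : cond_prob_version X A u -> cond_prob_version X A v ->
    P.-negligible [set w | u w < v w].
  move=> [mu ui uA] [mv vi vA]; set B := [set w | u w < v w].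
  have muv := measurable_funB mv mu.
  have sB : g_sigma_algebra_preimage X B.
    have -> : B = [set: T] `&` (v \- u) @^-1` `]0, +oo[%classic.
      by apply/seteqP; split => w;
        rewrite /B/= in_itv/= andbT subr_gt0 => // -[].
    exact: (muv measurableT _ (measurable_itv _)).
  have mB := g_sigma_algebra_preimage_sub sB.
  have mvu := g_sigma_algebra_preimage_measurable_fun muv.
  have mvuB : measurable_fun B (EFin \o (v \- u)).
    by apply: measurable_funTS; exact/measurable_EFinP.
  have : (\int[P]_(w in B) `|(EFin \o (v \- u)%R) w|)%E = 0%E.
    transitivity (\int[P]_(w in B) ((v w)%:E - (u w)%:E))%E.
      apply: eq_integral => w; rewrite inE => /ltW uv.
      by rewrite gee0_abs/= ?lee_fin ?subr_ge0// EFinB.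
    rewrite integralB//; last 2 first.
    - exact: integrableS vi.
    - exact: integrableS ui.
    rewrite (uA _ sB) -(vA _ sB) subee//; apply: integrable_fin_num => //.
    exact: integrableS vi.
  move=> /(ae_eq_integral_abs P mB mvuB) ae0.
  exists B; split => //; apply/eqP; apply: contrapT => /negP PB0.
  have [w Bw] := ae_witness mB PB0 ae0.
  move=> /(_ Bw) [] /eqP; rewrite subr_eq0 => /eqP e.
  by move: Bw; rewrite /B/= e ltxx.
apply: negligibleS (negligibleU (null _ _ vf vg) (null _ _ vg vf)) => w /= fg.
by apply/orP; rewrite -neq_lt; exact/eqP.
Qed.

End cond_prob.

Lemma inf_affine (R : realType) (m s : R) (B : set R) : 0 < s -> has_inf B ->
  inf [set m + s * z | z in B] = m + s * inf B.
Proof.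
move=> s0 infB; have [B0 [l lB]] := infB.
have infsB : has_inf [set m + s * z | z in B].
  split; first by case: B0 => z Bz; exists (m + s * z), z.
  by exists (m + s * l) => _ [z Bz <-]; rewrite lerD2l ler_pM2l// lB.
apply/eqP; rewrite eq_le; apply/andP; split.
  rewrite addrC -lerBlDr -ler_pdivrMl//; apply: lb_le_inf => // z Bz.
  rewrite ler_pdivrMl// lerBlDr addrC; apply: ge_inf; first by case: infsB.
  by exists z.
apply: lb_le_inf; first by case: infsB.
move=> _ [z Bz <-]; rewrite lerD2l ler_pM2l//; apply: ge_inf => //.
by exists l.
Qed.

Section quantile.
Context d (T : measurableType d) (R : realType) (P : probability T R).
Variable Y : {RV P >-> R}.
Notation std := (@normal_prob R 0 1).

Definition std_quantile (v : R) : R :=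
  inf [set z | (v%:E <= std [set x | (x <= z)%R])%E].

(** [inf] is meaningful only on nonempty sets bounded below. These properties come from the limits
    of the distribution function at both infinities, by [v < 1] and [0 < v] respectively. *)
Lemma has_inf_quantile (v : R) : 0 < v < 1 ->
  has_inf [set y | (v%:E <= cdf Y y)%E].
Proof.
move=> /andP[v0 v1].
have fin y : cdf Y y \is a fin_num by rewrite fin_num_measure.
split.
  have /fine_cvg/(cvgr_ge _)/(_ v v1)[M [_ HM]] := @cvg_cdfy1 _ _ _ _ Y.
  exists (M + 1) => /=; rewrite -(fineK (fin _)) lee_fin; apply: HM.
  by rewrite ltrDl.
have /fine_cvg/(cvgr_lt _)/(_ v v0)[M [_ HM]] := @cvg_cdfNy0 _ _ _ _ Y.
exists (M - 1) => y /= vy; rewrite leNgt; apply/negP => yM.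
have /= := HM (M - 1) ltac:(by rewrite ltrBlDr ltrDl).
rewrite ltNge => /negP; apply; rewrite -lee_fin (fineK (fin _)).
by rewrite (le_trans vy)// cdf_nondecreasing// ltW.
Qed.

Lemma quantile_normal (m s v : R) : 0 < s -> 0 < v < 1 ->
  (forall B, measurable B ->
    P [set w | B (Y w)] = std [set x | B (m + s * x)]) ->
  quantile Y v = m + s * std_quantile v.
Proof.
move=> s0 v01 law; have infY := has_inf_quantile v01.
set E := [set z | (v%:E <= std [set x | (x <= z)%R])%E].
have EE : [set y | (v%:E <= cdf Y y)%E] = [set m + s * z | z in E].
  have cE z : cdf Y (m + s * z) = std [set x | x <= z].
    rewrite /cdf /distribution /pushforward.
    rewrite (law _ (measurable_itv `]-oo, m + s * z])).
    by congr (normal_prob 0 1 _); apply/seteqP; split => x /=;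
      rewrite in_itv/= lerD2l ler_pM2l.
  apply/seteqP; split => [y /= vy|_ [z Ez <-]]; last by rewrite /= cE.
  exists ((y - m) / s); last by rewrite mulrC divfK ?gt_eqF// addrC subrK.
  by rewrite /E/= -cE mulrC divfK ?gt_eqF// addrC subrK.
rewrite /quantile EE inf_affine//.
have [[y0 Y0] [l lY]] := infY; split.
  by move: Y0; rewrite EE => -[z Ez _]; exists z.
exists ((l - m) / s) => z Ez; rewrite ler_pdivrMr// lerBlDl mulrC; apply: lY.
by rewrite EE; exists z.
Qed.

End quantile.

(** * Normal regression *)

Section stacked_vectors.
Variables (R : realType) (p : nat).

(** The body of [joint_vector] as a function of values, so that it also applies to the artificial
    response built on the product space. *)
Definition stack (y : R) (x : p.-tuple R) : 'cV[R]_(1 + p) :=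
  col_mx y%:M (\col_(i < p) tnth x i).

Lemma measurable_stack d (T : measurableType d) (f : T -> R)
    (g : T -> p.-tuple R) i : measurable_fun setT f -> measurable_fun setT g ->
  measurable_fun setT (fun w => stack (f w) (g w) i 0).
Proof.
move=> mf mg; case: (splitP i) => j ij.
  have -> : i = lshift p j by exact: val_inj.
  rewrite (_ : (fun _ => _) = f)//; apply/funext => w.
  by rewrite /stack col_mxEu mxE ord1 eqxx mulr1n.
have -> : i = rshift 1 j by exact: val_inj.
rewrite (_ : (fun _ => _) = (fun w => tnth (g w) j)).
  exact: measurableT_comp (measurable_tnth j) mg.
by apply/funext => w; rewrite /stack col_mxEd mxE.
Qed.

(** Puts joint events of [Y] and [X] into the form that [cramer_wold] accepts, namely preimages of
    sets in the sigma-algebra of the coordinates. *)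
Lemma stack_preimage_measurable (A : set R) (C : set (p.-tuple R)) :
  measurable A -> measurable C ->
  exists2 D : set 'cV[R]_(1 + p),
    g_sigma_preimage (fun i (v : 'cV[R]_(1 + p)) => v i 0) D &
    forall y x, D (stack y x) <-> A y /\ C x.
Proof.
move=> mA mC.
pose gen : set (set 'cV[R]_(1 + p)) := \big[setU/set0]_(i < 1 + p)
  preimage_set_system setT (fun v : 'cV[R]_(1 + p) => v i 0) measurable.
pose coord i (v : g_sigma_algebraType gen) : R := (v : 'cV[R]_(1 + p)) i 0.
have mcoord i : measurable_fun setT (coord i).
  move=> _ B mB; apply: sub_sigma_algebra; rewrite /gen -bigcup_seq.
  by exists i; [rewrite /= mem_index_enum|exists B].
pose tl (v : g_sigma_algebraType gen) : p.-tuple R :=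
  [tuple coord (rshift 1 j) v | j < p].
have mtl : measurable_fun setT tl.
  apply/measurable_fun_tnthP => j.
  rewrite (_ : _ \o _ = coord (rshift 1 j)); first exact: mcoord.
  by apply/funext => v; rewrite /= tnth_mktuple.
exists (coord (lshift p 0) @^-1` A `&` tl @^-1` C).
  have : measurable (coord (lshift p 0) @^-1` A `&` tl @^-1` C); last by [].
  by apply: measurableI; rewrite -[X in measurable X]setTI;
    [exact: mcoord|exact: mtl].
move=> y x.
have -> : (coord (lshift p 0) @^-1` A `&` tl @^-1` C) (stack y x) =
  (A (coord (lshift p 0) (stack y x)) /\ C (tl (stack y x))) by [].
have -> : coord (lshift p 0) (stack y x) = y.
  by rewrite /coord /stack col_mxEu mxE eqxx mulr1n.
suff -> : tl (stack y x) = x by [].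
by apply: eq_from_tnth => j; rewrite tnth_mktuple /coord /stack col_mxEd mxE.
Qed.

End stacked_vectors.

Section regression.
Context d (T : measurableType d) (R : realType) (P : probability T R) (p : nat).
Variables (Y : {RV P >-> R}) (X : {RV P >-> p.-tuple R}).
Variables (mu : 'cV[R]_(1 + p)) (Sigma : 'M[R]_(1 + p)) (G : 'M[R]_p).
Hypothesis nYX : mvnormal P (joint_vector Y X) mu Sigma.
Hypothesis ndY : nondegenerate Y.
Hypothesis SigmaG : ginverse (drsubmx Sigma) G.
Notation std := (@normal_prob R 0 1).
Notation var := (ulsubmx Sigma 0 0).
Notation r := (explained_ratio Sigma G).
Notation m := (mu (lshift p 0) 0).

Let Sigma_sym : Sigma^T = Sigma. Proof. by case: nYX. Qed.
Let Sigma_psd (t : 'rV[R]_(1 + p)) : 0 <= (t *m Sigma *m t^T) 0 0.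
Proof. by case: nYX. Qed.

Let centered (u : 'rV[R]_p) (x : p.-tuple R) : R :=
  (u *m (\col_(i < p) tnth x i - dsubmx mu)) 0 0.

Let dot_stack a u y (x : p.-tuple R) : (row_mx a%:M u *m stack y x) 0 0 =
  a * (y - m) + centered u x + (row_mx a%:M u *m mu) 0 0.
Proof.
have entryD (A B : 'M[R]_1) : (A + B) 0 0 = A 0 0 + B 0 0 by rewrite mxE.
have entryN (A : 'M[R]_1) : (- A) 0 0 = - A 0 0 by rewrite mxE.
rewrite /stack -[in RHS](vsubmxK mu) !mul_row_col /centered mulmxBr.
have entryZ k (A : 'M[R]_1) : (k *: A) 0 0 = k * A 0 0 by rewrite mxE.
rewrite !(entryD, entryN) !mul_scalar_mx !entryZ [y%:M 0 0]mxE eqxx mulr1n.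
by rewrite col_mxEu; ring.
Qed.

Lemma mvnormal_proj a u A : measurable A ->
  P [set w | A (a * (Y w - m) + centered u (X w))] =
  std [set x | A (Num.sqrt
    ((row_mx a%:M u *m Sigma *m (row_mx a%:M u)^T) 0 0) * x)].
Proof.
move=> mA; set t := row_mx a%:M u; set c := (t *m mu) 0 0.
pose B := [set y | A (y - c)].
have mB : measurable B.
  rewrite -[X in measurable X]setTI.
  have : measurable_fun setT (fun y : R => y - c) by exact: measurable_funB.
  exact.
case: nYX => _ psd /(_ t B mB); rewrite normal_lawE//.
rewrite (_ : [set w | B _] = [set w | A (a * (Y w - m) + centered u (X w))]).
  move=> ->; rewrite (_ : [set x | B _] =
    [set x | A (Num.sqrt ((t *m Sigma *m t^T) 0 0) * x)])//.
  by apply/seteqP; split => x; rewrite /B/= addrAC subrr add0r.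
by apply/seteqP; split => w; rewrite /B/= -/(stack _ _) dot_stack -/t -/c addrK.
Qed.

(** With variance 0, the centered [Y] has the law of the zero multiple of a standard normal
    variable, so [Y] equals its mean almost surely. *)
Lemma nondegenerate_var : var != 0.
Proof.
apply/eqP => v0; apply: ndY; exists m.
have := @mvnormal_proj 1 0 [set~ 0] (measurableC (measurable_set1 0)).
rewrite quadratic_form_row// trmx0 mulmx0 mul0mx mul0mx.
have E0 : (0 : 'M[R]_1) 0 0 = 0 by rewrite mxE.
rewrite E0 v0 !mulr0 !addr0 sqrtr0.
rewrite [X in std X](_ : _ = set0); last first.
  by apply/seteqP; split => x //=; rewrite mul0r => /(_ erefl).
rewrite measure0 => PY; exists (Y @^-1` [set~ m]); split.
- rewrite -[X in measurable X]setTI.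
  exact: (measurable_funP Y measurableT _ (measurableC (measurable_set1 m))).
- rewrite -[RHS]PY; congr (P _); apply/seteqP; split => w /=;
    rewrite /centered mul0mx E0 mul1r addr0; apply: contra_not.
    by move/eqP; rewrite subr_eq0 => /eqP.
  by move=> ->; rewrite subrr.
- by move=> w /=.
Qed.

(** * Regression on [X] plus independent noise *)

Let s := Num.sqrt var * Num.sqrt (1 - r).
Let W (x : p.-tuple R) := centered (regression_coef Sigma G) x.

Let measurable_centered u : measurable_fun setT (centered u).
Proof.
rewrite (_ : centered u = fun x => \sum_i u 0 i * (tnth x i - dsubmx mu i 0)).
  apply: measurable_sum => i; apply: measurable_funM => //.
  by apply: measurable_funB => //; exact: measurable_tnth.
apply/funext => x; rewrite /centered mxE.
by apply: eq_bigr => i _; rewrite !mxE.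
Qed.

Let Q : probability (T * measurableTypeR R)%type R := (P \x std)%E.
(** On the product space the second coordinate is noise independent of [X]; [s] is the residual
    standard deviation and [W] the centered linear predictor. *)
Let regression_sample (wc : T * measurableTypeR R) : R :=
  m + W (X wc.1) + s * wc.2.

Let measurable_sample : measurable_fun setT regression_sample.
Proof.
apply: measurable_funD; last exact: measurable_funM.
apply: measurable_funD => //; apply: measurableT_comp (measurable_centered _) _.
exact: measurableT_comp.
Qed.

Let law_centered u B : measurable B ->
  P [set w | B (centered u (X w))] =
  std [set x | B (Num.sqrt ((u *m drsubmx Sigma *m u^T) 0 0) * x)].
Proof.
move=> mB; have := @mvnormal_proj 0 u B mB; rewrite quadratic_form_row//.
rewrite expr0n/= mulr0 !mul0r !add0r => <-.
by congr (P _); apply/seteqP; split => w /=; rewrite mul0r add0r.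
Qed.

(** Up to the common mean, the right-hand projection is a combination [v] of the centered [X] plus
    [a * s] times the noise. Its variance is that on the left by [quadratic_form_residual], and
    [std_convolution] gives its law. *)
Let law_sample (t : 'rV[R]_(1 + p)) (A : set R) : measurable A ->
  P [set w | A ((t *m stack (Y w) (X w)) 0 0)] =
  Q [set wc | A ((t *m stack (regression_sample wc) (X wc.1)) 0 0)].
Proof.
move=> mA; have [a [u ->]] : exists a u, t = row_mx a%:M u.
  exists (t 0 (lshift p 0)), (rsubmx t).
  rewrite -[LHS]hsubmxK; congr row_mx; apply/matrixP => i j.
  by rewrite !ord1 !mxE eqxx mulr1n.
set t1 := row_mx a%:M u; set c := (t1 *m mu) 0 0.
pose B := [set y : R | A (y + c)].
have mB : measurable B.
  rewrite -[X in measurable X]setTI.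
  have : measurable_fun setT (fun y : R => y + c) by exact: measurable_funD.
  exact.
transitivity (P [set w | B (a * (Y w - m) + centered u (X w))]).
  by congr (P _); apply/seteqP; split => w; rewrite /B/= dot_stack.
rewrite mvnormal_proj// -/t1.
set v := a *: regression_coef Sigma G + u.
have v0 : var != 0 by exact: nondegenerate_var.
have q0 := Sigma_psd (row_mx 0%:M v).
rewrite quadratic_form_row// expr0n/= mulr0 !mul0r !add0r in q0.
have r01 := explained_ratio01 Sigma_sym Sigma_psd SigmaG v0.
have cE : Num.sqrt ((t1 *m Sigma *m t1^T) 0 0) ^+ 2 =
   Num.sqrt ((v *m drsubmx Sigma *m v^T) 0 0) ^+ 2 + (a * s) ^+ 2.
  rewrite !sqr_sqrtr//.
  rewrite (quadratic_form_residual Sigma_sym Sigma_psd SigmaG v0) -/v.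
  have /andP[r0 r1] := r01; have vp := var_gt0 Sigma_sym Sigma_psd v0.
  by rewrite !exprMn !sqr_sqrtr ?subr_ge0// ltW.
rewrite -(std_convolution cE mB).
have sE w : xsection [set wc : T * measurableTypeR R |
    A ((t1 *m stack (regression_sample wc) (X wc.1)) 0 0)] w =
    [set y | B (1 * centered v (X w) + a * s * y)].
  have cv : centered v (X w) = a * W (X w) + centered u (X w).
    rewrite /W /centered /v mulmxDl -scalemxAl.
    by rewrite [in LHS]mxE; congr (_ + _); rewrite mxE.
  apply/seteqP; split => y; rewrite /xsection/= inE/= dot_stack -/t1 -/c /B/=;
    rewrite /regression_sample/= cv; congr A; ring.
rewrite /Q/= /product_measure1; under [RHS]eq_integral do rewrite /= sE.
pose f x := std [set y | B (1 * x + a * s * y)].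
have mf : measurable_fun setT f by exact: measurable_std_section.
have f01 x : (0 <= f x <= 1)%E by exact: std_section01.
have m1 : measurable_fun setT
    (fun x : R => Num.sqrt ((v *m drsubmx Sigma *m v^T) 0 0) * x).
  exact: measurable_funM.
have m2 : measurable_fun setT (fun w => centered v (X w)).
  exact: measurableT_comp (measurable_centered _) _.
have /= <- := @eq_law_integral _ _ _ _ _ _ _ std P _ _ f m1 m2 mf.
- by apply: eq_integral => x _; rewrite /f mul1r.
- apply: integrable_le1; first exact: (measurableT_comp mf m1).
  by move=> w; exact: f01.
- apply: integrable_le1; first exact: (measurableT_comp mf m2).
  by move=> w; exact: f01.
- by move=> B' mB'; have := law_centered v mB'; exact: esym.
Qed.

(** The probability of the joint event is computed on the product space, where the section over [w]
    is empty unless [X w] lies in [C]. *)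
Lemma law_regression A C : measurable A -> measurable C ->
  P (Y @^-1` A `&` X @^-1` C) =
  (\int[P]_(w in X @^-1` C) std [set c | A (m + W (X w) + s * c)%R])%E.
Proof.
move=> mA mC; have [D mD DE] := stack_preimage_measurable mA mC.
have mX1 : measurable_fun setT (fun wc : T * measurableTypeR R => X wc.1).
  exact: measurableT_comp.
have := @cramer_wold _ _ _ _ _ P Q _ (fun w => stack (Y w) (X w))
  (fun wc => stack (regression_sample wc) (X wc.1))
  (fun i => measurable_stack i (measurable_funP Y) (measurable_funP X))
  (fun i => measurable_stack i measurable_sample mX1) law_sample D mD.
rewrite (_ : _ @^-1` D = Y @^-1` A `&` X @^-1` C); last first.
  by apply/seteqP; split => w /DE.
move=> ->; rewrite /Q/= /product_measure1 [RHS]integral_mkcond/=.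
apply: eq_integral => w _; rewrite patchE.
have [/set_mem Cw|/negP Cw] := boolP (w \in X @^-1` C).
  congr (std _); apply/seteqP; split => c; rewrite /xsection/= inE/=.
    by move=> /DE[].
  by move=> Ac; apply/DE.
rewrite (_ : xsection _ _ = set0) ?measure0//.
apply/seteqP; split => c //; rewrite /xsection/= inE/= => /DE[_ Cx].
by apply: Cw; rewrite inE.
Qed.

(** * The conditional probability of exceeding a quantile *)

Let quantile_regression v : 0 < v < 1 ->
  quantile Y v = m + Num.sqrt var * std_quantile v.
Proof.
move=> v01; have v0 := nondegenerate_var.
have vp := var_gt0 Sigma_sym Sigma_psd v0.
apply: quantile_normal => //; first by rewrite sqrtr_gt0.
move=> B mB; pose A := [set y : R | B (m + y)].
have mA : measurable A.
  rewrite -[X in measurable X]setTI.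
  have : measurable_fun setT (fun y : R => m + y) by exact: measurable_funD.
  exact.
have := @mvnormal_proj 1 0 A mA.
rewrite quadratic_form_row// trmx0 mulmx0 mul0mx mul0mx.
have E0 : (0 : 'M[R]_1) 0 0 = 0 by rewrite mxE.
rewrite E0 expr1n mul1r mulr0 !addr0 => <-; congr (P _).
by apply/seteqP; split => w /=;
  rewrite /A/= /centered mul0mx E0 mul1r addr0 addrC subrK.
Qed.

Let score w : R := W (X w) / Num.sqrt var.

Let measurable_score : measurable_fun setT score.
Proof.
apply: measurable_funM => //; exact: measurableT_comp (measurable_centered _) _.
Qed.

(** In units of the standard deviation of [Y], the predictor has variance [r]; mean, variance and
    dimension disappear at this point. *)
Let law_score A : measurable A ->
  P (score @^-1` A) = std [set x | A (Num.sqrt r * x)].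
Proof.
move=> mA; have v0 := nondegenerate_var.
have vp := var_gt0 Sigma_sym Sigma_psd v0.
have /andP[r0 r1] := explained_ratio01 Sigma_sym Sigma_psd SigmaG v0.
pose B := [set y : R | A (y / Num.sqrt var)].
have mB : measurable B.
  rewrite -[X in measurable X]setTI.
  by have : measurable_fun setT (fun y : R => y / Num.sqrt var);
    [exact: measurable_funM|exact].
have := law_centered (regression_coef Sigma G) mB.
rewrite -(explained_ratioE Sigma_sym Sigma_psd SigmaG v0) sqrtrM// => H.
rewrite [LHS]H; congr (std _).
by apply/seteqP; split => x /=;
  rewrite /B/= mulrAC mulfK// gt_eqF// sqrtr_gt0.
Qed.

Let version v w := std_tail (Num.sqrt (1 - r)) (std_quantile v) (score w).

Lemma cond_prob_version_regression v : 0 < v < 1 ->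
  cond_prob_version X [set w | quantile Y v <= Y w] (version v).
Proof.
move=> v01; have v0 := nondegenerate_var.
have vp := var_gt0 Sigma_sym Sigma_psd v0.
have sp : 0 < Num.sqrt var by rewrite sqrtr_gt0.
pose h x := std_tail (Num.sqrt (1 - r)) (std_quantile v) (W x / Num.sqrt var).
have mh : measurable_fun setT h.
  apply: measurableT_comp; first exact: measurable_std_tail.
  by apply: measurable_funM => //; exact: measurable_centered.
split.
- move=> _ B mB; exists (h @^-1` B) => //.
  by rewrite -[X in measurable X]setTI; exact: mh.
- apply: (@bounded_integrable _ _ _ _ _ 1).
    exact: measurableT_comp mh _.
  move=> w; have /andP[h0 h1] := std_tail01 (Num.sqrt (1 - r))
    (std_quantile v) (score w).
  by rewrite ger0_norm.
- move=> _ [C mC <-]; rewrite setTI.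
  have := law_regression (measurable_itv `[quantile Y v, +oo[) mC.
  rewrite [X in P (X `&` _)](_ : _ = [set w | quantile Y v <= Y w]); last first.
    by apply/seteqP; split => w /=; rewrite in_itv/= andbT.
  move=> ->; apply: eq_integral => w _; rewrite /version EFin_std_tail.
  (* After subtracting [m], both sides of the inequality carry the positive factor
     [Num.sqrt var]. *)
  have E c : (quantile Y v <= m + W (X w) + s * c) =
      (std_quantile v <= score w + Num.sqrt (1 - r) * c).
    rewrite quantile_regression// -addrA lerD2l -[RHS](ler_pM2l sp).
    by congr (_ <= _); rewrite /score /s; field; rewrite gt_eqF.
  congr (normal_prob 0 1 _); apply/seteqP; split => c /=;
    by rewrite in_itv/= andbT E.
Qed.

Lemma expectation_convex_cond_prob (v : R) (f : T -> R) (phi : R -> R) :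
  0 < v < 1 ->
  cond_prob_version X [set w | quantile Y v <= Y w] f ->
  convex_function [set: R^o] phi ->
  ('E_P[phi \o f] = (tail_functional phi (std_quantile v) r)%:E)%E.
Proof.
move=> v01 vf cphi; have vv := cond_prob_version_regression v01.
have [M phiM] := convex_bounded01 cphi.
have mphi := measurable_convex cphi.
pose k := std_tail (Num.sqrt (1 - r)) (std_quantile v).
have mt : measurable_fun setT (phi \o k).
  exact: (measurableT_comp mphi (measurable_std_tail _ _)).
have mtE : measurable_fun setT (fun x => (phi (k x))%:E).
  exact/measurable_EFinP.
have m1 : measurable_fun setT (fun x : R => Num.sqrt r * x).
  exact: measurable_funM.
have i1 : std.-integrable setT
    (EFin \o (fun x : R => phi (k (Num.sqrt r * x)))).
  apply: (@bounded_integrable _ _ _ _ _ M).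
    exact: (measurableT_comp mt m1).
  by move=> x; rewrite phiM// std_tail01.
have mv : measurable_fun setT (EFin \o (phi \o version v)).
  exact/measurable_EFinP/(measurableT_comp mt measurable_score).
transitivity (\int[P]_w (phi (version v w))%:E)%E.
  rewrite unlock; apply: ae_eq_integral => //.
    apply/measurable_EFinP/(measurableT_comp mphi).
    by case: vf => mf _ _; exact: g_sigma_algebra_preimage_measurable_fun mf.
  have := cond_prob_version_unique vf vv.
  by apply: filterS => w /= -> _.
rewrite /tail_functional /Rintegral fineK; last exact: integrable_fin_num i1.
have iv : P.-integrable setT (EFin \o (fun w => phi (version v w))).
  apply: (@bounded_integrable _ _ _ _ _ M).
    exact: (measurableT_comp mt measurable_score).
  by move=> w; rewrite phiM// std_tail01.
apply/esym; apply: (@eq_law_integral _ _ _ _ _ _ _ std P _ score _ m1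
  measurable_score mtE i1 iv) => A mA.
by rewrite law_score.
Qed.

End regression.

Theorem theorem3p1 (R : realType)
    (d d' : measure_display) (T : measurableType d) (T' : measurableType d')
    (P : probability T R) (P' : probability T' R) (p p' : nat)
    (Y : {RV P >-> R}) (X : {RV P >-> p.-tuple R})
    (Y' : {RV P' >-> R}) (X' : {RV P' >-> p'.-tuple R})
    (mu : 'cV[R]_(1 + p)) (mu' : 'cV[R]_(1 + p'))
    (Sigma : 'M[R]_(1 + p)) (Sigma' : 'M[R]_(1 + p'))
    (SigmaX_inv : 'M[R]_p) (SigmaX'_inv : 'M[R]_p') :
  mvnormal P (joint_vector Y X) mu Sigma ->
  mvnormal P' (joint_vector Y' X') mu' Sigma' ->
  nondegenerate Y ->
  nondegenerate Y' ->
  ginverse (drsubmx Sigma) SigmaX_inv ->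
  ginverse (drsubmx Sigma') SigmaX'_inv ->
  ccx_le Y X Y' X' <->
  explained_ratio Sigma SigmaX_inv <= explained_ratio Sigma' SigmaX'_inv.
Proof.
move=> nYX nYX' ndY ndY' GX GX'.
have r01 : 0 <= explained_ratio Sigma SigmaX_inv <= 1.
  case: (nYX) => sym psd _; apply: explained_ratio01 => //.
  exact: nondegenerate_var nYX ndY.
have r01' : 0 <= explained_ratio Sigma' SigmaX'_inv <= 1.
  case: (nYX') => sym psd _; apply: explained_ratio01 => //.
  exact: nondegenerate_var nYX' ndY'.
have /andP[r0 r1] := r01; have /andP[r0' r1'] := r01'.
split=> [ccx|rr' v v01 f f' vf vf' phi cphi].
  rewrite leNgt; apply/negP => r'r.
  (* A single level suffices, and 1/2 is arbitrary: the square separates different ratios at every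
     threshold. *)
  have v01 : 0 < (2^-1 : R) < 1 by apply/andP; split; lra.
  have vf := cond_prob_version_regression nYX ndY GX v01.
  have vf' := cond_prob_version_regression nYX' ndY' GX' v01.
  have := ccx _ v01 _ _ vf vf' _ (@convex_sqr R).
  rewrite (expectation_convex_cond_prob nYX ndY GX v01 vf (@convex_sqr R)).
  rewrite (expectation_convex_cond_prob nYX' ndY' GX' v01 vf' (@convex_sqr R)).
  by rewrite lee_fin leNgt lt_tail_functional_sqr.
rewrite (expectation_convex_cond_prob nYX ndY GX v01 vf cphi).
rewrite (expectation_convex_cond_prob nYX' ndY' GX' v01 vf' cphi).
by rewrite lee_fin le_tail_functional.
Qed.
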